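(* Every $4$-Ore graph has at least four triangles. Moreover, a $4$-Ore graph $G$ has exactly four triangles if and only if $G$ is a $\mathrm{Pl}_{4,4f}$-graph.
   Context: All graphs are finite and simple. A graph is $4$-critical if it is not $3$-colorable but every proper subgraph is $3$-colorable. An Ore-composition $O(G_1,G_2)$ of vertex-disjoint graphs $G_1,G_2$ is obtained as follows: delete some edge $xy$ of $G_1$; split some vertex $z$ of $G_2$ into two new nonadjacent vertices $z_1,z_2$ of positive degree (i.e. remove $z$ and partition its neighbourhood into two nonempty parts, making $z_1$ adjacent to the first part and $z_2$ to the second); identify $x$ with $z_1$ and $y$ with $z_2$. A graph is $4$-Ore if it is obtained from a set of copies of $K_4$ by a sequence of Ore-compositions. A $\mathrm{Pl}_4$-graph is a planar $4$-critical graph with exactly four triangles; a $\mathrm{Pl}_{4,4f}$-graph is a $\mathrm{Pl}_4$-graph that has a plane drawing with no face of length $4$. *)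

(* Defs.v *)
From mathcomp Require Import all_boot perm.

Set Implicit Arguments.
Unset Strict Implicit.
Unset Printing Implicit Defensive.

Record sgraph : Type := SGraph {
  vertex :> finType;
  adj : rel vertex;
  adj_sym : symmetric adj;
  adj_irr : irreflexive adj }.

Arguments adj {s} _ _.

Section Basics.

Variable G : sgraph.

Definition neighbours (v : G) : {set G} := [set w | adj v w].

Definition colorable (k : nat) : Prop :=
  exists f : G -> 'I_k, forall u v : G, adj u v -> f u != f v.

Definition triangles : {set {set G}} :=
  [set A : {set G} |
    (#|A| == 3) && [forall u in A, forall v in A, (u != v) ==> adj u v]].

End Basics.

Definition isomorphic (G H : sgraph) : Prop :=
  exists2 h : G -> H, bijective h & forall u v : G, adj (h u) (h v) = adj u v.

(* [h] exhibits [H] as a (not necessarily induced) subgraph of [G]. *)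
Definition subgraph_via (H G : sgraph) (h : H -> G) : Prop :=
  injective h /\ forall u v : H, adj u v -> adj (h u) (h v).

(* Some vertex, or some edge between present vertices, of [G] is missing. *)
Definition proper_subgraph_via (H G : sgraph) (h : H -> G) : Prop :=
  subgraph_via h /\
  ((exists w : G, forall u : H, h u != w) \/
   (exists u v : H, adj (h u) (h v) /\ ~~ adj u v)).

Definition four_critical (G : sgraph) : Prop :=
  ~ colorable G 3 /\
  forall (H : sgraph) (h : H -> G), proper_subgraph_via h -> colorable H 3.

Section OreComposition.

Variables (G1 G2 : sgraph) (x y : G1) (z : G2) (A : {set G2}).

(* After the identifications z1 = x and z2 = y, the vertices are those of G1
   together with those of G2 other than z.  The neighbours of z in A are
   attached to x, the remaining ones to y. *)
Definition ore_vertex : finType := (G1 + {w : G2 | w != z})%type.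

Definition ore_link (a : G1) (w : G2) : bool :=
  adj z w && ((a == x) && (w \in A) || (a == y) && (w \notin A)).

Definition ore_adj (u v : ore_vertex) : bool :=
  match u, v with
  | inl a, inl b =>
      adj a b && ~~ ((a == x) && (b == y) || (a == y) && (b == x))
  | inl a, inr w => ore_link a (val w)
  | inr w, inl a => ore_link a (val w)
  | inr w, inr w' => adj (val w) (val w')
  end.

Lemma ore_adj_sym : symmetric ore_adj.
Proof.
move=> [a|w] [b|w'] //=; last exact: adj_sym.
by rewrite adj_sym orbC [(b == y) && _]andbC [(b == x) && _]andbC.
Qed.

Lemma ore_adj_irr : irreflexive ore_adj.
Proof. by move=> [a|w] /=; rewrite adj_irr. Qed.

Definition ore_composition : sgraph := SGraph ore_adj_sym ore_adj_irr.

End OreComposition.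

Lemma neq_sym (T : eqType) : symmetric (fun a b : T => a != b).
Proof. by move=> a b; rewrite eq_sym. Qed.

Lemma neq_irr (T : eqType) : irreflexive (fun a b : T => a != b).
Proof. by move=> a; rewrite eqxx. Qed.

Definition K4 : sgraph := @SGraph 'I_4 _ (@neq_sym 'I_4) (@neq_irr 'I_4).

(* Disjointness is built into the sum type in [ore_vertex], and the same graph
   may be used several times, each time as a fresh copy. *)
Inductive four_Ore : sgraph -> Prop :=
| four_Ore_K4 (G : sgraph) : isomorphic G K4 -> four_Ore G
| four_Ore_comp (G1 G2 G : sgraph) (x y : G1) (z : G2) (A : {set G2}) :
    four_Ore G1 -> four_Ore G2 ->
    adj x y -> A != set0 -> A \proper neighbours z ->
    isomorphic G (ore_composition x y z A) -> four_Ore G.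

(* Plane drawings are represented, up to homeomorphism, by rotation systems of
   genus zero (planar combinatorial maps). *)
Section Drawings.

Variable G : sgraph.

(* Each edge uv yields the two darts (u, v) and (v, u), with tails u and v. *)
Definition dart : finType := {d : G * G | adj d.1 d.2}.

Definition tail (d : dart) : G := (val d).1.

Lemma dart_rev_subproof (d : dart) : adj (val d).2 (val d).1.
Proof. by rewrite adj_sym (valP d). Qed.

Definition dart_rev (d : dart) : dart :=
  exist (fun d : G * G => adj d.1 d.2) ((val d).2, (val d).1) (dart_rev_subproof d).

Definition rotation_system (r : {perm dart}) : Prop :=
  forall d d' : dart, (d' \in porbit r d) = (tail d' == tail d).

(* Walk along d = (u, v), then leave v by the dart following (v, u) around v.
   The orbits are the facial walks. *)
Definition face_step (r : {perm dart}) (d : dart) : dart := r (dart_rev d).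

Definition nonisolated : {set G} := [set v : G | [exists w, adj v w]].

(* Euler's formula V + F = E + 2C.  Isolated vertices carry no dart, so they are
   left out of V and C; facial walks are counted component by component, so F
   exceeds the number of faces by C - 1 and each component contributes
   V - E + F <= 2, with equality exactly when it is embedded in the sphere. *)
Definition plane_drawing (r : {perm dart}) : Prop :=
  rotation_system r /\
  #|nonisolated| + fcard (face_step r) {: dart}
    = #|dart|./2 + (n_comp (@adj G) nonisolated).*2.

Definition planar : Prop := exists r : {perm dart}, plane_drawing r.

(* The length of the face to one side of the dart d, counting an edge twice when
   both of its sides lie on the face.  This is the length of the face boundary
   when G is connected, hence in particular when G is 4-critical. *)
Definition face_length (r : {perm dart}) (d : dart) : nat :=
  fingraph.order (face_step r) d.

End Drawings.

Definition Pl4 (G : sgraph) : Prop :=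
  [/\ planar G, four_critical G & #|triangles G| = 4].

Definition Pl44f (G : sgraph) : Prop :=
  Pl4 G /\
  exists2 r : {perm dart G},
    plane_drawing r & forall d : dart G, face_length r d != 4.

(* Main.v *)
(* Write T1 for the number of triangles of G1 other than those through the
   deleted edge xy, and T2 for the number of triangles of G2 that survive the
   splitting of z; the composition has T1 + T2 triangles.  By induction, deleting
   a vertex of a 4-Ore graph other than K4 leaves at least two triangles, whence
   T1, T2 >= 2.  If T1 + T2 = 4, then G1 and G2 again have exactly four triangles,
   because an edge of a 4-Ore graph lies in at most two triangles.  Moreover xy is
   the middle edge of a diamond of G1, and the two triangles of G2 at z are both
   destroyed: either they share an edge zw, z has degree 3 and w is split off from
   the other two neighbours, or they form a bow tie, and then G2 is the Moser
   spindle with centre z.  In both cases the split part of G2 can be inserted into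
   the 4-face of G1 - xy, and the four triangular faces at xy and at the split
   corners of z merge into two faces of length 5. *)

(* Two strengthened induction hypotheses carry the proof. For the counts, two triangles of G2
   avoiding z do not by themselves bound the number of triangles through z; [rigid] gives this
   bound, and its second clause makes the first one inductive. For the drawings, [structured] adds
   what the next gluing needs: the middle vertices of a diamond have degree 3, a bow tie occurs only
   at the centre of a Moser spindle, and the middle edge of a diamond has triangular faces on both
   sides. As xy is such an edge, and zw too in the diamond case, the faces to be merged are known to
   be triangles. In the rotation systems the deleted darts xy and yx are identified with two darts
   of G2 at z, one for each split corner. A merged face then has 3 + 3 - 1 = 5 darts, and Euler's
   formula follows from three counts: the composition has 1 vertex, 2 darts and 2 faces fewer than
   G1 and G2 together. Criticality is proved for the splittings that occur: one side of z has at
   most two vertices, which leaves a third colour free for that side. *)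
Require Import Defs.
From mathcomp Require Import all_boot perm zify.

Set Implicit Arguments.
Unset Strict Implicit.
Unset Printing Implicit Defensive.

(** * Triangles *)

Section Triangles.

Variable G : sgraph.
Implicit Types (u v w : G) (t : {set G}).

Lemma adj_neq u v : adj u v -> u != v.
Proof. by apply: contraTneq => ->; rewrite adj_irr. Qed.

Lemma triangle_adj t u v :
  t \in triangles G -> u \in t -> v \in t -> u != v -> adj u v.
Proof.
rewrite inE => /andP[_ /forall_inP tP] tu tv.
by have /forall_inP/(_ v tv)/implyP := tP u tu.
Qed.

Lemma card_triangle t : t \in triangles G -> #|t| = 3.
Proof. by rewrite inE => /andP[/eqP]. Qed.

Lemma triangleI t :
  #|t| = 3 -> {in t &, forall u v, u != v -> adj u v} -> t \in triangles G.
Proof.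
move=> t3 tP; rewrite inE t3 eqxx /=.
by apply/forall_inP => u tu; apply/forall_inP => v tv; apply/implyP/tP.
Qed.

Lemma cards3 (T : finType) (a b c : T) :
  a != b -> b != c -> a != c -> #|[set a; b; c]| = 3.
Proof. by move=> ab bc ac; rewrite setUC cardsU1 !inE cards2 ab negb_or ![c == _]eq_sym ac bc. Qed.

Lemma triangle3 u v w :
  adj u v -> adj v w -> adj u w -> [set u; v; w] \in triangles G.
Proof.
move=> uv vw uw; apply: triangleI; first by rewrite cards3 ?adj_neq.
move=> p q; rewrite !inE => /orP[/orP[]|] /eqP -> /orP[/orP[]|] /eqP ->;
  by rewrite ?eqxx // adj_sym.
Qed.

Lemma triangle_split t u : t \in triangles G -> u \in t ->
  exists v w, [/\ t = [set u; v; w], adj u v, adj v w & adj u w].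
Proof.
move=> tG tu; have t3 := card_triangle tG.
have /eqP/cards2P[v [w [vw tE]]] : #|t :\ u| = 2 by move: t3; rewrite (cardsD1 u t) tu => -[].
have [tv uv] : v \in t /\ u != v.
  by have : v \in t :\ u by [rewrite tE !inE eqxx]; rewrite !inE eq_sym => /andP[].
have [tw uw] : w \in t /\ u != w.
  by have : w \in t :\ u by [rewrite tE !inE eqxx orbT]; rewrite !inE eq_sym => /andP[].
exists v, w; split; try exact: triangle_adj tG _ _ _.
by rewrite -setUA -tE setD1K.
Qed.

Lemma triangle_split2 t u v : t \in triangles G -> u \in t -> v \in t -> u != v ->
  exists w, [/\ t = [set u; v; w], adj u v, adj v w & adj u w].
Proof.
move=> tG tu tv uv; have [p [q [tE up pq uq]]] := triangle_split tG tu.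
move: tv; rewrite tE !inE eq_sym (negPf uv) /= => /orP[] /eqP vE; subst v.
  by exists q.
by exists p; split=> //; [rewrite setUAC | rewrite adj_sym].
Qed.

Definition avoiding v := [set t in triangles G | v \notin t].

(* The edge uv lies in the two triangles uvp and uvq. *)
Definition cn2 u v p q := [&& adj u v, p != q, adj u p, adj v p, adj u q & adj v q].

Definition edge_triangles u v := [set t in triangles G | (u \in t) && (v \in t)].

Definition common u v := [set p | adj u p && adj v p].

Lemma edge_trianglesE u v : adj u v ->
  edge_triangles u v = [set [set u; v; p] | p in common u v].
Proof.
move=> uv; apply/setP => t; rewrite inE; apply/andP/imsetP => [[tG /andP[tu tv]]|[p]].
  have [w [-> _ vw uw]] := triangle_split2 tG tu tv (adj_neq uv).
  by exists w; rewrite // inE uw vw.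
rewrite inE => /andP[up vp] ->; split; first exact: triangle3.
by rewrite !inE !eqxx orbT.
Qed.

Lemma card_edge_triangles u v : adj u v -> #|edge_triangles u v| = #|common u v|.
Proof.
move=> uv; rewrite edge_trianglesE // card_in_imset // => p q.
rewrite !inE => /andP[up vp] /andP[uq vq] /setP/(_ p).
rewrite !inE eqxx orbT eq_sym (negPf (adj_neq up)) eq_sym (negPf (adj_neq vp)) /=.
by move/esym/eqP.
Qed.

Lemma triangles_avoiding v :
  #|triangles G| = #|avoiding v| + #|[set t in triangles G | v \in t]|.
Proof.
rewrite -(cardsID [set t : {set G} | v \notin t] (triangles G)); congr (_ + _); apply: eq_card => t.
  by rewrite !inE.
by rewrite !inE negbK andbC.
Qed.

End Triangles.

Section Iso.

Variables (G H : sgraph) (h : G -> H).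
Hypotheses (bh : bijective h) (hadj : forall u v, adj (h u) (h v) = adj u v).

Let ih : injective h := bij_inj bh.

Lemma triangles_iso (t : {set G}) : (h @: t \in triangles H) = (t \in triangles G).
Proof.
rewrite !inE card_imset //; congr (_ && _).
apply/forall_inP/forall_inP => tP u.
  move=> tu; apply/forall_inP => v tv; apply/implyP => uv.
  have /forall_inP/(_ (h v))/implyP := tP (h u) (imset_f _ tu).
  by rewrite imset_f // (inj_eq ih) uv hadj /=; apply.
case/imsetP => u' tu ->; apply/forall_inP => v /imsetP[v' tv ->].
rewrite (inj_eq ih) hadj.
by have /forall_inP/(_ v' tv) := tP u' tu.
Qed.

Lemma imset_iso_surj (t : {set H}) : exists s : {set G}, t = h @: s.
Proof.
case: bh => g hK gK; exists (g @: t).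
by rewrite -imset_comp (eq_imset _ (gK : h \o g =1 id)) imset_id.
Qed.

Lemma card_triangles_iso (P : pred {set H}) :
  #|[set t in triangles H | P t]| = #|[set t : {set G} in triangles G | P (h @: t)]|.
Proof.
rewrite -(card_imset _ (imset_inj ih)); apply: eq_card => t.
have [s ->] := imset_iso_surj t.
by rewrite (mem_imset _ _ (imset_inj ih)) inE [RHS]inE triangles_iso.
Qed.

Lemma card_triangles_isoT : #|triangles H| = #|triangles G|.
Proof.
have E (K : sgraph) : triangles K = [set t in triangles K | true].
  by apply/setP => t; rewrite [RHS]inE andbT.
by rewrite [in LHS]E card_triangles_iso -E.
Qed.

Lemma card_avoiding_iso (v : G) : #|avoiding (h v)| = #|avoiding v|.
Proof.
rewrite card_triangles_iso; apply: eq_card => t.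
by rewrite inE [RHS]inE mem_imset.
Qed.

End Iso.

(** Being isomorphic to K4, expressed without choosing a bijection. *)
Definition isK4 (G : sgraph) := #|G| = 4 /\ forall u v : G, adj u v = (u != v).

Section Complete.

Variable G : sgraph.
Hypothesis GK4 : isK4 G.

Lemma triangles_K4 (t : {set G}) : (t \in triangles G) = (#|t| == 3).
Proof.
apply/idP/eqP => [/card_triangle //|t3]; apply: triangleI => // u v _ _.
by rewrite GK4.2.
Qed.

Lemma card_triangles_K4 : #|triangles G| = 4.
Proof.
have -> : triangles G = [set t : {set G} | #|t| == 3].
  by apply/setP => t; rewrite triangles_K4 inE.
by rewrite card_draws GK4.1.
Qed.

Lemma card_avoiding_K4 (v : G) : #|avoiding v| = 1.
Proof.
have -> : avoiding v = [set t : {set G} | t \subset [set~ v] & #|t| == 3].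
  apply/setP => t; rewrite inE triangles_K4 inE andbC; congr (_ && _).
  by rewrite subsetC sub1set inE.
by rewrite cards_draws cardsC1 GK4.1.
Qed.

Lemma card_common_K4 (u v : G) : u != v -> #|common u v| = 2.
Proof.
move=> uv; have -> : common u v = ~: [set u; v].
  by apply/setP => p; rewrite !inE !GK4.2 negb_or ![p == _]eq_sym.
by rewrite cardsCs setCK cards2 uv GK4.1.
Qed.

Lemma others_K4 (z : G) : exists a b c,
  [/\ uniq [:: z; a; b; c] & forall v, v \in [:: z; a; b; c]].
Proof.
have c3 : #|[set~ z]| = 3 by rewrite cardsC1 GK4.1.
have /card_gt0P[a az] : 0 < #|[set~ z]| by rewrite c3.
have /eqP/cards2P[b [c [bc bcE]]] : #|[set~ z] :\ a| = 2.
  by move: c3; rewrite (cardsD1 a) az => -[].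
have E : [set~ z] = [set a; b; c] by rewrite -setUA -bcE setD1K.
have [ab ac] : a != b /\ a != c.
  by have := setD11 a [set~ z]; rewrite bcE !inE => /negbT; rewrite negb_or => /andP[].
have zE p : (p == z) = (p \notin [set a; b; c]).
  by rewrite -E !inE negbK.
exists a, b, c; split=> [|v]; last first.
  by have := zE v; rewrite !inE; case: (v == z); rewrite //= !negb_or; case: (v == a) (v == b) (v == c) => [] [] [].
have := zE z; rewrite eqxx /= !inE !negb_or => /esym/andP[/andP[-> ->] ->].
by rewrite ab ac bc.
Qed.

End Complete.

Lemma isK4_iso G H : isomorphic G H -> isK4 H -> isK4 G.
Proof.
case=> h bh hadj [c4 aE]; split; first by rewrite (bij_eq_card bh).
by move=> u v; rewrite -hadj aE (inj_eq (bij_inj bh)).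
Qed.

Lemma isK4_K4 : isK4 K4.
Proof. by split=> //; rewrite card_ord. Qed.

(** * Triangles of an Ore-composition *)

Section Ore.

Variables (G1 G2 : sgraph) (x y : G1) (z : G2) (A : {set G2}).
Hypothesis xy : adj x y.

Local Notation O := (ore_composition x y z A).
Local Notation lft a := (inl a : O).
Local Notation rgt w := (inr w : O).

(** The contraction of the copy of G1 to z, which undoes the composition on the side of G2. *)
Definition ore_proj (u : O) : G2 := if u is inr w then val w else z.

Lemma inr_adj_proj (w : {w : G2 | w != z}) (u : O) :
  adj (rgt w) u -> adj (val w) (ore_proj u).
Proof. by case: u => [a|w'] //= /andP[zw _]; rewrite adj_sym. Qed.

(** A right vertex has at most one left neighbour, because its link goes to x or to y but not to
    both. So the contraction, which collapses all of G1, is still injective on the neighbourhood of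
    a right vertex. *)
Lemma ore_proj_inj (w : {w : G2 | w != z}) (u v : O) :
  adj (rgt w) u -> adj (rgt w) v -> ore_proj u = ore_proj v -> u = v.
Proof.
case: u v => [a|u] [b|v] /=.
- move=> /andP[_ h1] /andP[_ h2] _; congr inl.
  by move: h1 h2; case: (val w \in A); rewrite ?andbT ?andbF ?orbF /= => /eqP-> /eqP->.
- by move=> _ _ E; have := valP v; rewrite /= -E eqxx.
- by move=> _ _ E; have := valP u; rewrite /= E eqxx.
- by move=> _ _ /val_inj ->.
Qed.

Definition attach (w : G2) : G1 := if w \in A then x else y.

Lemma ore_adj_lr (a : G1) (w : {w : G2 | w != z}) :
  adj (lft a) (rgt w) = adj z (val w) && (a == attach (val w)).
Proof.
by rewrite /= /ore_link /attach; case: (val w \in A); rewrite ?andbT ?andbF ?orbF.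
Qed.

Lemma ore_adj_rl (a : G1) (w : {w : G2 | w != z}) :
  adj (rgt w) (lft a) = adj z (val w) && (a == attach (val w)).
Proof. by rewrite adj_sym ore_adj_lr. Qed.

Lemma ore_adj_ll (a b : G1) :
  adj (lft a) (lft b) = [&& adj a b, (a, b) != (x, y) & (a, b) != (y, x)].
Proof. by rewrite /= negb_or !xpair_eqE. Qed.

Lemma ore_adj_xy : adj (lft x) (lft y) = false.
Proof. by rewrite ore_adj_ll eqxx !andbF. Qed.

Lemma ore_adj_yx : adj (lft y) (lft x) = false.
Proof. by rewrite ore_adj_ll eqxx !andbF. Qed.

(** The left end of a link is determined by w, so adjacent left vertices cannot both be linked to w.
    Hence a triangle with a left edge lies entirely on the left. *)
Lemma no_mixed (a b : G1) (w : {w : G2 | w != z}) :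
  adj (lft a) (lft b) -> adj (lft a) (rgt w) -> adj (lft b) (rgt w) -> False.
Proof.
rewrite !ore_adj_lr => ab /andP[_ /eqP E1] /andP[_ /eqP E2].
by move: (adj_neq ab); rewrite E1 E2 eqxx.
Qed.

Definition left_triangles := [set t in triangles G1 | ~~ ((x \in t) && (y \in t))].

(** For a triangle through z: its other two vertices are attached to the same end of xy, so the
    split keeps the triangle. *)
Definition unmixed (t : {set G2}) := (t :\ z \subset A) || [disjoint t :\ z & A].

Definition right_triangles := [set t in triangles G2 | (z \in t) ==> unmixed t].

(* The copy of w in the composition when w is a vertex of a surviving triangle t;
   the copy of z depends on the side of the split on which t lies. *)
Definition lift_vertex (t : {set G2}) (w : G2) : O :=
  if insub w is Some w' then rgt w'
  else lft (if t :\ z \subset A then x else y).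

Definition lift_triangle (t : {set G2}) : {set O} := lift_vertex t @: t.

Lemma lift_vertexK t : cancel (lift_vertex t) ore_proj.
Proof.
move=> w; rewrite /lift_vertex; case: insubP => [w' _ //|]; rewrite negbK => /eqP ->.
by [].
Qed.

Lemma lift_vertex_neq t (w : {w : G2 | w != z}) : lift_vertex t (val w) = rgt w.
Proof. by rewrite /lift_vertex valK. Qed.

Lemma lift_vertex_z t :
  lift_vertex t z = lft (if t :\ z \subset A then x else y).
Proof. by rewrite /lift_vertex insubF // eqxx. Qed.

Lemma attach_unmixed t w : unmixed t -> w \in t -> w != z ->
  attach w = if t :\ z \subset A then x else y.
Proof.
move=> ut tw wz; have tzw : w \in t :\ z by rewrite !inE wz.
rewrite /attach; case/orP: ut => [tA|dA]; first by rewrite tA (subsetP tA).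
rewrite (disjointFr dA tzw); case: ifP => // /subsetP/(_ _ tzw).
by rewrite (disjointFr dA tzw).
Qed.

Lemma left_triangle_ore t : t \in left_triangles -> inl @: t \in triangles O.
Proof.
rewrite inE => /andP[tG nxy]; apply: triangleI.
  by rewrite card_imset ?(card_triangle tG) //; exact: inl_inj.
move=> _ _ /imsetP[u tu ->] /imsetP[v tv ->]; rewrite (inj_eq inl_inj) => uv.
rewrite ore_adj_ll (triangle_adj tG tu tv uv) /=.
apply/andP; split; apply: contraNneq nxy => -[<- <-]; exact/andP.
Qed.

Lemma right_triangle_ore t : t \in right_triangles -> lift_triangle t \in triangles O.
Proof.
rewrite inE => /andP[tG zt]; apply: triangleI.
  by rewrite card_imset ?(card_triangle tG) //; exact: can_inj (lift_vertexK t).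
have zadj v : z \in t -> v \in t -> v != z -> adj (lift_vertex t z) (lift_vertex t v).
  move=> tz tv vz; rewrite lift_vertex_z -[v](SubK {w | w != z} vz) lift_vertex_neq.
  rewrite ore_adj_lr SubK -(attach_unmixed (implyP zt tz) tv vz) eqxx andbT.
  by apply: triangle_adj tG tz tv _; rewrite eq_sym.
move=> _ _ /imsetP[u tu ->] /imsetP[v tv ->].
rewrite (inj_eq (can_inj (lift_vertexK t))) => uv.
have [uz|uz] := eqVneq u z; first by subst u; apply: zadj; rewrite // eq_sym.
have [vz|vz] := eqVneq v z; first by subst v; rewrite adj_sym; apply: zadj.
rewrite -[u](SubK {w | w != z} uz) -[v](SubK {w | w != z} vz) !lift_vertex_neq /=.
exact: triangle_adj tG tu tv uv.
Qed.

(** A triangle with a right vertex projects injectively to G2. If it also has a left vertex, the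
    others are attached to that vertex and hence lie on one side of the split. A triangle without
    right vertices is one of G1, and it cannot contain both x and y because xy is gone. *)
Lemma ore_triangle_cases t : t \in triangles O ->
  (exists2 s, s \in left_triangles & t = inl @: s) \/
  (exists2 s, s \in right_triangles & t = lift_triangle s).
Proof.
move=> tO; have [/exists_inP[u tu]|] := boolP [exists u in t, if u is inr _ then true else false].
  case: u tu => // w tw _; right.
  have aE a v : lft a \in t -> rgt v \in t -> a = attach (val v).
    by move=> ta tv; have := triangle_adj tO ta tv isT; rewrite ore_adj_lr => /andP[_ /eqP].
  have sR : ore_proj @: t \in right_triangles.
    have pinj : {in t &, injective ore_proj}.
      move=> u v tu tv E.
      have [uw|uw] := eqVneq (rgt w) u; have [vw|vw] := eqVneq (rgt w) v.
      - by rewrite -uw.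
      - by have := inr_adj_proj (triangle_adj tO tw tv vw); rewrite -E -uw /= adj_irr.
      - by have := inr_adj_proj (triangle_adj tO tw tu uw); rewrite E -vw /= adj_irr.
      - exact: ore_proj_inj (triangle_adj tO tw tu uw) (triangle_adj tO tw tv vw) E.
    have tri : ore_proj @: t \in triangles G2.
      apply: triangleI; first by rewrite card_in_imset ?(card_triangle tO).
      move=> _ _ /imsetP[u tu ->] /imsetP[v tv ->]; rewrite (inj_in_eq pinj) // => uv.
      have := triangle_adj tO tu tv uv.
      case: u v tu tv uv => [a|u] [b|v] tu tv uv; last by [].
      - by move=> ab; case: (no_mixed ab (triangle_adj tO tu tw _) (triangle_adj tO tv tw _)).
      - by rewrite ore_adj_lr => /andP[].
      - by rewrite ore_adj_rl adj_sym => /andP[].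
    rewrite inE tri /=; apply/implyP => /imsetP[[a|v] ta /= zE]; last first.
      by have := valP v; rewrite /= -zE eqxx.
    rewrite /unmixed; have [aA|aA] := boolP (val w \in A); apply/orP; [left|right].
      apply/subsetP => p; rewrite !inE => /andP[pz /imsetP[[b|q] tq /= E]].
        by rewrite E eqxx in pz.
      have := aE _ _ ta tw; rewrite (aE _ _ ta tq) /attach aA -[val q]E.
      by case: (p \in A) => // E'; move: xy; rewrite E' adj_irr.
    rewrite disjoint_subset; apply/subsetP => p; rewrite !inE.
    move=> /andP[pz /imsetP[[b|q] tq /= E]]; first by rewrite E eqxx in pz.
    have := aE _ _ ta tw; rewrite (aE _ _ ta tq) /attach (negPf aA) -[val q]E.
    by case: (p \in A) => // E'; move: xy; rewrite E' adj_irr.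
  exists (ore_proj @: t) => //.
  rewrite /lift_triangle -imset_comp -[LHS]imset_id; apply: eq_in_imset => -[a|v] ta /=.
    move: sR; rewrite lift_vertex_z inE => /andP[_ /implyP zs].
    rewrite -(@attach_unmixed _ (val w)) ?(valP w) ?(aE _ _ ta tw) //.
      by apply: zs; apply/imsetP; exists (lft a).
    by apply/imsetP; exists (rgt w).
  by rewrite lift_vertex_neq.
move=> noR.
have tE : t = inl @: (inl @^-1: t).
  apply/setP => -[a|w]; first by rewrite (mem_imset _ _ inl_inj) inE.
  apply/idP/imsetP => [tw|[//]].
  by case/exists_inP: noR; exists (rgt w).
left; exists (inl @^-1: t) => //; rewrite inE; apply/andP; split.
  apply: triangleI; first by rewrite -(card_triangle tO) [in RHS]tE card_imset //; exact: inl_inj.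
  move=> u v; rewrite !inE => tu tv uv.
  by have := triangle_adj tO tu tv; rewrite (inj_eq inl_inj) ore_adj_ll => /(_ uv)/andP[].
rewrite !inE; apply/negP => /andP[tx ty].
have := triangle_adj tO tx ty; rewrite (inj_eq inl_inj) => /(_ (adj_neq xy)).
by rewrite ore_adj_xy.
Qed.

Lemma lift_triangle_inj : injective lift_triangle.
Proof.
have K : cancel lift_triangle (fun t => ore_proj @: t).
  move=> t; rewrite /lift_triangle -imset_comp -[RHS]imset_id; apply: eq_imset => u /=.
  exact: lift_vertexK.
exact: can_inj K.
Qed.

(** The predicate lets one bijection count both all triangles and those that avoid a given
    vertex. *)
Lemma card_ore_triangles (P : pred {set O}) :
  #|[set t in triangles O | P t]| =
  #|[set t in left_triangles | P (inl @: t)]| +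
  #|[set t in right_triangles | P (lift_triangle t)]|.
Proof.
have inlI : injective (inl : G1 -> O) by exact: inl_inj.
rewrite -(card_imset _ (imset_inj inlI)) -(card_imset _ lift_triangle_inj).
(* A triangle of G2 has a vertex other than z, so its lift has a right vertex. *)
have dis t : t \in right_triangles -> forall s : {set G1}, lift_triangle t != inl @: s.
  move=> tR s; apply/eqP => E.
  move: (tR); rewrite inE => /andP[tG _].
  have /card_gt0P[u] : 0 < #|t :\ z|.
    by move: (cardsD1 z t); rewrite (card_triangle tG); case: (z \in t); case: #|t :\ z|.
  rewrite !inE => /andP[uz tu].
  have : lift_vertex t u \in inl @: s by rewrite -E imset_f.
  by rewrite -[u](SubK {w | w != z} uz) lift_vertex_neq => /imsetP[].
rewrite -cardsUI [X in _ + X](_ : _ = 0) ?addn0.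
  apply: eq_card => t; rewrite [LHS]inE [RHS]inE; apply/andP/orP => [[tO Pt]|].
    case: (ore_triangle_cases tO) => [[s sL tE]|[s sR tE]]; [left|right].
      by apply/imsetP; exists s; rewrite // inE sL -tE.
    by apply/imsetP; exists s; rewrite // inE sR -tE.
  case=> /imsetP[s]; rewrite inE => /andP[sT Ps] ->; split=> //.
    exact: left_triangle_ore.
  exact: right_triangle_ore.
apply/eqP; rewrite cards_eq0; apply/eqP/setP => t; rewrite !inE; apply/negP.
case/andP=> /imsetP[s _ ->] /imsetP[s']; rewrite inE => /andP[s'R _] /esym/eqP.
by rewrite (negPf (dis _ s'R s)).
Qed.

Lemma card_ore_trianglesT : #|triangles O| = #|left_triangles| + #|right_triangles|.
Proof.
have E (T : finType) (B : {set T}) : #|[set t in B | true]| = #|B|.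
  by apply: eq_card => t; rewrite inE andbT.
by have := card_ore_triangles predT; rewrite /= !E.
Qed.

End Ore.

(** * Triangle counts along Ore-compositions and the lower bound *)

Record triangle_rich (G : sgraph) : Prop := TriangleRich {
  avoiding_gt0 : forall v : G, 0 < #|avoiding v|;
  avoiding_gt1 : isK4 G \/ forall v : G, 1 < #|avoiding v|;
  common_le2 : forall u v : G, adj u v -> #|common u v| <= 2 }.

(** The first clause recovers four triangles in G2 when only two avoid z. The second one serves the
    induction: if w meets all surviving triangles of G2, then z and w meet all triangles of G2. *)
Definition rigid (G : sgraph) : Prop :=
  (isK4 G \/ forall v : G, #|avoiding v| <= 2 -> #|triangles G| <= 4) /\
  forall v w : G, (forall t, t \in triangles G -> (v \in t) || (w \in t)) ->
    #|triangles G| <= 4.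

Lemma unmixed3 (G : sgraph) (z p q : G) (A : {set G}) : z != p -> z != q ->
  unmixed z A [set z; p; q] = ((p \in A) == (q \in A)).
Proof.
move=> zp zq; rewrite /unmixed -setUA setU1K; last by rewrite !inE negb_or zp.
rewrite subUset !sub1set -setI_eq0 setIUl setU_eq0 !setI_eq0 !disjoints1.
by case: (p \in A) (q \in A) => [] [].
Qed.

Section Count.

Variables (G1 G2 : sgraph) (x y : G1) (z : G2) (A : {set G2}).
Hypotheses (xy : adj x y) (A0 : A != set0) (Az : A \proper neighbours z).
Hypotheses (rich1 : triangle_rich G1) (rich2 : triangle_rich G2).

Local Notation O := (ore_composition x y z A).
Local Notation lft a := (inl a : O).
Local Notation rgt w := (inr w : O).
Local Notation L := (left_triangles x y).
Local Notation R := (right_triangles z A).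

Lemma left_triangles_edge : #|triangles G1| = #|L| + #|common x y|.
Proof.
rewrite -(card_edge_triangles xy) addnC.
rewrite -(cardsID [set t : {set G1} | (x \in t) && (y \in t)]).
by congr (_ + _); apply: eq_card => t; rewrite [LHS]inE [RHS]inE !inE // andbC.
Qed.

Lemma left_avoiding v : #|avoiding v| <= #|[set t in L | v \notin t]| + #|common x y|.
Proof.
rewrite -(card_edge_triangles xy); apply: leq_trans (leq_card_setU _ _).
apply/subset_leq_card/subsetP => t; rewrite !inE => /andP[-> ->].
by rewrite andbT /=; case: (_ && _).
Qed.

Lemma right_triangles_z : #|R| = #|avoiding z| + #|[set t in R | z \in t]|.
Proof.
rewrite -(cardsID [set t : {set G2} | z \notin t] R); congr (_ + _); apply: eq_card => t.
  by rewrite !inE; case: (z \in t); rewrite ?andbF ?andbT.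
by rewrite !inE negbK andbC.
Qed.

(** A nonempty proper part of the three neighbours of z has one or two elements; w is the neighbour
    that is alone on its side. *)
Lemma K4_split : isK4 G2 -> exists w c d,
  [/\ uniq [:: z; w; c; d], forall v, v \in [:: z; w; c; d],
      (c \in A) = (w \notin A) & (d \in A) = (w \notin A)].
Proof.
move=> K; have [a [b [c [U C]]]] := others_K4 K z.
have [AN [e eN eA]] := properP Az; have [f fA] := set0Pn _ A0.
have zA : z \notin A by apply/negP => /(subsetP AN); rewrite inE adj_irr.
have : ~~ [&& a \in A, b \in A & c \in A].
  apply/negP => /and3P[aA bA cA]; have := C e; rewrite !inE.
  by case/or4P => /eqP E; move: eA eN; rewrite ?E ?aA ?bA ?cA // inE adj_irr.
have : [|| a \in A, b \in A | c \in A].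
  have := C f; rewrite !inE.
  by case/or4P => /eqP E; move: fA; rewrite E ?(negPf zA) // => ->; rewrite ?orbT.
have P2 : uniq [:: z; b; a; c] /\ forall v, v \in [:: z; b; a; c].
  split=> [|v]; first by rewrite -(perm_uniq (s1 := [:: z; a; b; c])) // perm_cons (perm_catCA [:: a] [:: b]).
  by have := C v; rewrite !inE => /or4P[] ->; rewrite ?orbT.
have P3 : uniq [:: z; c; a; b] /\ forall v, v \in [:: z; c; a; b].
  split=> [|v]; last by have := C v; rewrite !inE => /or4P[] ->; rewrite ?orbT.
  by rewrite -(perm_uniq (s1 := [:: z; a; b; c])) // perm_cons (perm_catC [:: a; b] [:: c]).
have [U2 C2] := P2; have [U3 C3] := P3.
case aA: (a \in A); case bA: (b \in A); case cA: (c \in A) => //= _ _.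
- by exists c, a, b; rewrite aA bA cA.
- by exists b, a, c; rewrite aA bA cA.
- by exists a, b, c; rewrite aA bA cA.
- by exists a, b, c; rewrite aA bA cA.
- by exists b, a, c; rewrite aA bA cA.
- by exists c, a, b; rewrite aA bA cA.
Qed.

(** The survivors are the triangle wcd avoiding z and the triangle zcd, since c and d are the only
    two neighbours on the same side. *)
Lemma right_triangles_K4 : isK4 G2 -> #|R| = 2.
Proof.
move=> K; rewrite right_triangles_z card_avoiding_K4 //.
have [w [c [d [U C cA dA]]]] := K4_split K.
have adjK (u v : G2) : adj u v = (u != v) by rewrite K.2.
suff -> : [set t in R | z \in t] = [set [set z; c; d]] by rewrite cards1.
move: U; rewrite /= !inE !negb_or => /and4P[/and3P[zw zc zd] /andP[wc wd] cd _].
apply/setP => t; rewrite [LHS]inE [RHS]inE; apply/andP/eqP => [[]|->]; last first.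
  split; last by rewrite !inE eqxx.
  by rewrite inE triangle3 ?adjK //= unmixed3 // cA dA eqxx implybT.
rewrite inE => /andP[tG /implyP ut] zt; have := ut zt.
have [p [q [-> zp pq zq]]] := triangle_split tG zt.
rewrite unmixed3 ?adj_neq //.
move: zp pq zq (C p) (C q); rewrite !adjK !inE ![_ == z]eq_sym => /negPf-> pq /negPf-> /=.
move=> /or3P[] /eqP Ep /or3P[] /eqP Eq; subst p q => //; rewrite ?eqxx ?cA ?dA // in pq *.
- by case: (w \in A).
- by case: (w \in A).
- by case: (w \in A).
- by case: (w \in A).
- by rewrite setUAC.
Qed.

(** Triangles avoiding x do not use the edge xy. In K4 only one triangle avoids x, and the count is
    4 - 2 instead. *)
Lemma left_ge2 : 1 < #|L|.
Proof.
case: (avoiding_gt1 rich1) => [K|/(_ x) h].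
  have := left_triangles_edge; rewrite card_triangles_K4 // card_common_K4 ?adj_neq //.
  by rewrite -[4]/(2 + 2) => /addIn <-.
apply: leq_trans h _; apply/subset_leq_card/subsetP => t.
by rewrite !inE => /andP[-> /negPf->].
Qed.

Lemma right_ge2 : 1 < #|R|.
Proof.
case: (avoiding_gt1 rich2) => [K|/(_ z) h]; first by rewrite right_triangles_K4.
by rewrite right_triangles_z; apply: leq_trans h (leq_addr _ _).
Qed.

Lemma ore_triangles_ge4 : 4 <= #|triangles O|.
Proof. by rewrite (card_ore_trianglesT _ _ xy) -[4]/(2 + 2) leq_add ?left_ge2 ?right_ge2. Qed.

Lemma mem_lift_triangle w t : (rgt w \in lift_triangle x y z A t) = (val w \in t).
Proof.
rewrite -(lift_vertex_neq x y A t w) /lift_triangle mem_imset //.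
exact: can_inj (lift_vertexK x y z A t).
Qed.

Lemma lift_triangle_lft a t : lft a \in lift_triangle x y z A t -> z \in t.
Proof.
case/imsetP => w tw; rewrite /lift_vertex; case: insubP => //=.
by rewrite negbK => /eqP <-.
Qed.

Lemma lift_triangle_interior a t : a != x -> a != y ->
  lft a \notin lift_triangle x y z A t.
Proof.
move=> ax ay; apply/imsetP => -[w tw].
rewrite /lift_vertex; case: insubP => // _ [E].
by move: ax ay; rewrite E; case: ifP; rewrite eqxx.
Qed.

Lemma avoiding_lft a : a != x -> a != y ->
  #|avoiding (lft a)| = #|[set t in L | a \notin t]| + #|R|.
Proof.
move=> ax ay; rewrite (card_ore_triangles xy); congr (_ + _); apply: eq_card => t.
  by rewrite !inE (mem_imset _ _ (@inl_inj _ _)).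
by rewrite [LHS]inE lift_triangle_interior ?andbT.
Qed.

Lemma avoiding_rgt w :
  #|avoiding (rgt w)| = #|L| + #|[set t in R | val w \notin t]|.
Proof.
rewrite (card_ore_triangles xy); congr (_ + _); apply: eq_card => t.
  rewrite [LHS]inE; case: (t \in L) => //=.
  by apply/imsetP => -[].
by rewrite [LHS]inE [RHS]inE mem_lift_triangle.
Qed.

(** A triangle avoiding one end of xy does not contain xy, and one avoiding z is untouched by the
    split; in the composition neither kind contains a. *)
Lemma avoiding_xy a : (a == x) || (a == y) ->
  #|avoiding a| + #|avoiding z| <= #|avoiding (lft a)|.
Proof.
move=> axy; rewrite (card_ore_triangles xy); apply: leq_add.
  apply/subset_leq_card/subsetP => t /setIdP[tG at_].
  rewrite inE [_ \in L]inE tG (mem_imset _ _ (@inl_inj _ _)) at_ andbT /=.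
  by apply: contra at_ => /andP[xt yt]; case/orP: axy => /eqP->.
apply/subset_leq_card/subsetP => t /setIdP[tG zt].
rewrite inE [_ \in R]inE tG (negPf zt) /=.
by apply: contra zt; apply: lift_triangle_lft.
Qed.

(** At x and y the bound arises as 1 + 1, one triangle from each factor, which is why
    [triangle_rich] also records the bound 1 that holds for K4. Elsewhere the factor not containing
    v supplies two triangles. *)
Lemma ore_avoiding_gt1 (v : O) : 1 < #|avoiding v|.
Proof.
case: v => [a|w]; last first.
  by rewrite avoiding_rgt; apply: leq_trans left_ge2 (leq_addr _ _).
have [axy|] := boolP ((a == x) || (a == y)).
  apply: leq_trans (avoiding_xy axy); rewrite -[2]/(1 + 1).
  by rewrite leq_add ?(avoiding_gt0 rich1) ?(avoiding_gt0 rich2).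
rewrite negb_or => /andP[ax ay]; rewrite avoiding_lft //.
exact: leq_trans right_ge2 (leq_addl _ _).
Qed.

Lemma common_proj (u : O) w : adj u (rgt w) ->
  #|common u (rgt w)| <= #|common (ore_proj u) (val w)|.
Proof.
move=> uw; rewrite -(card_in_imset (f := @ore_proj _ _ x y z A)).
  apply/subset_leq_card/subsetP => _ /imsetP[p + ->]; rewrite !inE => /andP[up wp].
  rewrite (inr_adj_proj wp) andbT.
  case: u uw up => [a|u] uw up; last exact: inr_adj_proj up.
  case: p up wp => [b|p] up wp; last by move: up; rewrite ore_adj_lr => /andP[].
  by case: (no_mixed up uw); rewrite adj_sym.
move=> p q; rewrite !inE => /andP[_ wp] /andP[_ wq]; exact: ore_proj_inj wp wq.
Qed.

(** The common neighbours of an edge with a right end inject into those of its projection in G2;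
    those of a left edge are all left vertices. *)
Lemma ore_common_le2 (u v : O) : adj u v -> #|common u v| <= 2.
Proof.
have inr_case (u' : O) w : adj u' (rgt w) -> #|common u' (rgt w)| <= 2.
  move=> uw; apply: leq_trans (common_proj uw) _; apply: (common_le2 rich2).
  by rewrite adj_sym; apply: inr_adj_proj; rewrite adj_sym.
case: v => [b|w]; last exact: inr_case.
case: u => [a|w]; last first.
  move=> wb; have -> : common (rgt w) (lft b) = common (lft b) (rgt w).
    by apply/setP => p; rewrite !inE andbC.
  by apply: inr_case; rewrite adj_sym.
move=> ab; have ab1 : adj a b by move: ab; rewrite ore_adj_ll => /and3P[].
apply: leq_trans (common_le2 rich1 ab1).
have inlI : injective (inl : G1 -> O) by exact: inl_inj.
rewrite -(card_imset _ inlI).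
apply/subset_leq_card/subsetP => -[p|w]; rewrite inE => /andP[ap bp]; last first.
  by case: (no_mixed ab ap bp).
by rewrite mem_imset // inE; move: ap bp; rewrite !ore_adj_ll => /and3P[-> _ _] /and3P[-> _ _].
Qed.

Lemma ore_rich : triangle_rich O.
Proof.
split=> [v||]; [exact: ltnW (ore_avoiding_gt1 v)|right; exact: ore_avoiding_gt1|].
exact: ore_common_le2.
Qed.

Hypotheses (rigid1 : rigid G1) (rigid2 : rigid G2).

(* If G1 is not K4, at least two triangles avoid v and all of them contain xy. *)
Lemma left_le2 v : (forall t, t \in L -> v \in t) -> #|L| <= 2.
Proof.
move=> vL; case: (avoiding_gt1 rich1) => [K|h].
  have := left_triangles_edge; rewrite card_triangles_K4 // card_common_K4 ?adj_neq //.
  by rewrite -[4]/(2 + 2) => /addIn <-.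
have L0 : #|[set t in L | v \notin t]| = 0.
  by apply: eq_card0 => t; apply: negbTE; apply/negP => /setIdP[/vL ->].
have := left_avoiding v; rewrite L0 add0n => le1.
have c2 : #|common x y| = 2.
  by apply/eqP; rewrite eqn_leq (common_le2 rich1) //= (leq_trans (h v) le1).
case: rigid1 => -[K|r] _.
  by have := h v; rewrite card_avoiding_K4.
by have := r v; rewrite left_triangles_edge c2 in le1 *; rewrite -[4]/(2 + 2) leq_add2r; apply.
Qed.

(** Outside the case of K4, the triangles of R contain w and at least two more triangles avoid w;
    together they are among the at most four triangles that the second clause of [rigid] allows. *)
Lemma right_le2 w : (forall t, t \in R -> w \in t) -> #|R| <= 2.
Proof.
move=> wR; case: (avoiding_gt1 rich2) => [K|h]; first by rewrite right_triangles_K4.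
have T4 : #|triangles G2| <= 4.
  apply: (rigid2.2 z w) => t tG; case zt: (z \in t) => //=.
  by apply: wR; rewrite inE tG zt.
rewrite -(leq_add2r 2); apply: leq_trans T4.
apply: leq_trans (leq_add (leqnn _) (h w)) _.
rewrite -cardsUI [X in _ + X](_ : _ = 0) ?addn0.
  by apply/subset_leq_card/subsetP => t; rewrite !inE => /orP[] /andP[].
apply: eq_card0 => t; apply: negbTE; apply/negP => /setIP[/wR tw] /setIdP[_].
by rewrite tw.
Qed.

Lemma ore_rigid : rigid O.
Proof.
split; [right => v|move=> v w].
  case: v => [a|w].
    have [axy le2|] := boolP ((a == x) || (a == y)).
      (* Each factor contributes at least one triangle, and at least two unless it is K4. A total of
         two forces both factors to be K4. *)
      have := leq_trans (avoiding_xy axy) le2 => {}le2.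
      have K1 : isK4 G1.
        case: (avoiding_gt1 rich1) => // /(_ a) h.
        by have := leq_trans (leq_add h (avoiding_gt0 rich2 z)) le2.
      have K2 : isK4 G2.
        case: (avoiding_gt1 rich2) => // /(_ z) h.
        by have := leq_trans (leq_add (avoiding_gt0 rich1 a) h) le2.
      rewrite (card_ore_trianglesT _ _ xy) right_triangles_K4 // -[4]/(2 + 2) leq_add2r.
      have := left_triangles_edge; rewrite card_triangles_K4 // card_common_K4 ?adj_neq //.
      by rewrite -[4]/(2 + 2) => /addIn <-.
    rewrite negb_or => /andP[ax ay]; rewrite avoiding_lft // => le2.
    have R2 : #|R| <= 2 by apply: leq_trans (leq_addl _ _) le2.
    have L0 : #|[set t in L | a \notin t]| = 0.
      by apply/eqP; rewrite -leqn0 -(leq_add2r 2); apply: leq_trans le2; rewrite leq_add2l right_ge2.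
    rewrite (card_ore_trianglesT _ _ xy) -[4]/(2 + 2) leq_add //.
    apply: (left_le2 (v := a)) => t tL; apply: contraT => at_.
    by have := card0_eq L0 t; rewrite inE tL at_.
  rewrite avoiding_rgt => le2.
  have L2 : #|L| <= 2 by apply: leq_trans (leq_addr _ _) le2.
  have R0 : #|[set t in R | val w \notin t]| = 0.
    by apply/eqP; rewrite -leqn0 -(leq_add2l 2); apply: leq_trans le2; rewrite leq_add2r left_ge2.
  rewrite (card_ore_trianglesT _ _ xy) -[4]/(2 + 2) leq_add //.
  apply: (right_le2 (w := val w)) => t tL; apply: contraT => at_.
  by have := card0_eq R0 t; rewrite inE tL at_.
have inlI : injective (inl : G1 -> O) by exact: inl_inj.
have LO t : t \in L -> inl @: t \in triangles O by exact: left_triangle_ore.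
have RO t : t \in R -> lift_triangle x y z A t \in triangles O.
  exact: right_triangle_ore.
have inL (t : {set G1}) p : (rgt p \in inl @: t) = false by apply/imsetP => -[].
(* Two right vertices miss every left triangle. For a left vertex a and a right vertex p, a meets
   all of L, so it is not an end of xy: a triangle of G1 avoiding such an end would survive unmet.
   Hence p meets all of R. *)
have rgt_case (u : O) p : (forall t, t \in triangles O -> (u \in t) || (rgt p \in t)) ->
    #|triangles O| <= 4.
  case: u => [a|q] uP; last first.
    have /card_gt0P[t tL] := ltnW left_ge2.
    by have := uP _ (LO t tL); rewrite !inL.
  have aL t : t \in L -> a \in t.
    by move=> tL; have := uP _ (LO t tL); rewrite inL orbF mem_imset.
  have [axy|] := boolP ((a == x) || (a == y)).
    have /card_gt0P[t /setIdP[tG at_]] := avoiding_gt0 rich1 a.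
    suff /aL : t \in L by rewrite (negPf at_).
    rewrite inE tG; apply: contra at_ => /andP[xt yt].
    by case/orP: axy => /eqP->.
  rewrite negb_or => /andP[ax ay].
  rewrite (card_ore_trianglesT _ _ xy) -[4]/(2 + 2) leq_add ?(left_le2 aL) //.
  apply: (right_le2 (w := val p)) => t tR; have := uP _ (RO t tR).
  by rewrite (negPf (lift_triangle_interior _ ax ay)) mem_lift_triangle.
case: v w => [a|p] [b|q] vwP; try exact: rgt_case vwP.
  (* Two left vertices miss the lift of a triangle of G2 that avoids z. *)
  have /card_gt0P[t /setIdP[tG zt]] := avoiding_gt0 rich2 z.
  have := vwP _ (RO t _); rewrite inE tG (negPf zt) => /(_ isT).
  by case/orP => /lift_triangle_lft; rewrite (negPf zt).
by apply: (rgt_case (lft b) p) => t tO; rewrite orbC vwP.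
Qed.

End Count.

Lemma common_iso (G H : sgraph) (h : G -> H) (u v : G) : bijective h ->
  (forall u v, adj (h u) (h v) = adj u v) -> #|common (h u) (h v)| = #|common u v|.
Proof.
move=> bh hadj; rewrite -(card_imset _ (bij_inj bh)); apply: eq_card => p.
have [g hK gK] := bh; rewrite -(gK p) mem_imset ?inE ?hadj //; exact: bij_inj.
Qed.

Lemma triangle_rich_iso G H : isomorphic G H -> triangle_rich H -> triangle_rich G.
Proof.
move=> GH; have [h bh hadj] := GH; case=> R1 R2 F2; split=> [v||u v uv].
- by rewrite -(card_avoiding_iso bh hadj).
- case: R2 => [/(isK4_iso GH)|R2]; [by left|right => v].
  by rewrite -(card_avoiding_iso bh hadj).
- by rewrite -(common_iso _ _ bh hadj) F2 ?hadj.
Qed.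

Lemma rigid_iso G H : isomorphic G H -> rigid H -> rigid G.
Proof.
move=> GH; have [h bh hadj] := GH; case=> f g; split.
  case: f => [/(isK4_iso GH)|f]; [by left|right => v].
  by rewrite -(card_triangles_isoT bh hadj) -(card_avoiding_iso bh hadj); exact: f.
move=> v w vw; rewrite -(card_triangles_isoT bh hadj); apply: (g (h v) (h w)) => t.
have [s ->] := imset_iso_surj bh t.
by rewrite (triangles_iso bh hadj) !(mem_imset _ _ (bij_inj bh)); apply: vw.
Qed.

Lemma isK4_rich G : isK4 G -> triangle_rich G.
Proof.
move=> K; split; [by move=> v; rewrite card_avoiding_K4|by left|].
by move=> u v uv; rewrite card_common_K4 ?adj_neq.
Qed.

Lemma isK4_rigid G : isK4 G -> rigid G.
Proof. by move=> K; split=> [|*]; [left|rewrite card_triangles_K4]. Qed.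

Lemma four_Ore_rich_rigid G : four_Ore G -> triangle_rich G /\ rigid G.
Proof.
elim=> {G} [G /isK4_iso/(_ isK4_K4) K|G1 G2 G x y z A _ [r1 g1] _ [r2 g2] xy A0 Az GO].
  by split; [exact: isK4_rich|exact: isK4_rigid].
by split; [apply: triangle_rich_iso GO _; exact: ore_rich|
  apply: rigid_iso GO _; exact: ore_rigid].
Qed.

Lemma four_Ore_ge4 G : four_Ore G -> 4 <= #|triangles G|.
Proof.
case=> {G} [G /isK4_iso/(_ isK4_K4) K|G1 G2 G x y z A o1 o2 xy A0 Az [h bh hadj]].
  by rewrite card_triangles_K4.
rewrite -(card_triangles_isoT bh hadj).
have [r1 _] := four_Ore_rich_rigid o1; have [r2 _] := four_Ore_rich_rigid o2.
exact: ore_triangles_ge4.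
Qed.

(** * Compositions with exactly four triangles *)

Section FourTriangles.

Variables (G1 G2 : sgraph) (x y : G1) (z : G2) (A : {set G2}).
Hypotheses (xy : adj x y) (A0 : A != set0) (Az : A \proper neighbours z).
Hypotheses (o1 : four_Ore G1) (o2 : four_Ore G2).

Local Notation O := (ore_composition x y z A).
Local Notation L := (left_triangles x y).
Local Notation R := (right_triangles z A).

Hypothesis T4 : #|triangles O| = 4.

Let r1 := (four_Ore_rich_rigid o1).1.
Let r2 := (four_Ore_rich_rigid o2).1.

Lemma left_eq2 : #|L| = 2.
Proof.
apply/eqP; rewrite eqn_leq left_ge2 // andbT -(leq_add2r 2).
rewrite -[2 + 2]T4 (card_ore_trianglesT _ _ xy) leq_add2l; exact: right_ge2.
Qed.

Lemma right_eq2 : #|R| = 2.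
Proof.
by have := card_ore_trianglesT z A xy; rewrite T4 left_eq2 -[4]/(2 + 2) => /addnI.
Qed.

(** Two triangles survive, at least four exist, and at most two contain xy; so exactly two contain
    xy. *)
Lemma left_triangles4 : #|triangles G1| = 4 /\ exists a b, cn2 x y a b.
Proof.
have E := left_triangles_edge xy; rewrite left_eq2 in E.
have c2 : #|common x y| = 2.
  apply/eqP; rewrite eqn_leq (common_le2 r1) //= -(leq_add2l 2) -E.
  exact: four_Ore_ge4.
split; first by rewrite E c2.
have /eqP/cards2P[a [b [ab cE]]] := c2.
have : a \in common x y by rewrite cE !inE eqxx.
have : b \in common x y by rewrite cE !inE eqxx orbT.
rewrite !inE => /andP[xb yb] /andP[xa ya].
by exists a, b; rewrite /cn2 xy ab xa ya xb.
Qed.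

(** In K4 the destroyed triangles are zwc and zwd, where w is alone on its side. Otherwise the two
    survivors are already the triangles avoiding z, so every triangle at z is destroyed, and
    rigidity leaves exactly two of them. The order within each pair records which vertex is in A. *)
Lemma right_triangles4 : #|triangles G2| = 4 /\ exists p q p' q',
  [/\ (p \in A) && (q \notin A), (p' \in A) && (q' \notin A), (p, q) != (p', q'),
      [&& adj z p, adj z q & adj p q] & [&& adj z p', adj z q' & adj p' q']].
Proof.
case: (avoiding_gt1 r2) => [K|h].
  split; first exact: card_triangles_K4.
  have [w [c [d [U _ cA dA]]]] := K4_split A0 Az K.
  move: U; rewrite /= !inE !negb_or => /and4P[/and3P[zw zc zd] /andP[wc wd] cd _].
  case wA: (w \in A) cA dA => /= cA dA.
    by exists w, c, w, d; rewrite wA cA dA !K.2 zw zc zd wc wd xpair_eqE eqxx (negPf cd).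
  exists c, w, d, w; rewrite wA cA dA !K.2 zw zc zd xpair_eqE eqxx andbT.
  by rewrite ![_ == w]eq_sym wc wd cd.
have E := right_triangles_z z A; rewrite right_eq2 in E.
have Rz : #|[set t in R | z \in t]| = 0.
  by apply/eqP; rewrite -leqn0 -(leq_add2l 2) addn0 [X in _ <= X]E leq_add2r h.
have a2 : #|avoiding z| = 2 by rewrite E Rz addn0.
have G24 : #|triangles G2| = 4.
  apply/eqP; rewrite eqn_leq four_Ore_ge4 // andbT.
  case: (four_Ore_rich_rigid o2).2 => -[K|f _]; first by rewrite card_triangles_K4.
  by apply: (f z); rewrite a2.
split=> //; have := triangles_avoiding z; rewrite G24 a2 -[4]/(2 + 2) => /addnI/esym/eqP.
case/cards2P => s [t [st tE]].
have get r : r \in [set s; t] -> exists p q,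
    [/\ r = [set z; p; q], (p \in A) && (q \notin A) & [&& adj z p, adj z q & adj p q]].
  rewrite -tE => /setIdP[rG zr]; have [p [q [rE zp pq zq]]] := triangle_split rG zr.
  have : r \notin R.
    by apply/negP => rR; have := card0_eq Rz r; rewrite inE rR zr.
  rewrite inE rG zr /= rE unmixed3 ?adj_neq //.
  case pA: (p \in A); case qA: (q \in A) => // _; first by exists p, q; rewrite pA qA zp pq zq.
  by exists q, p; rewrite pA qA zp zq adj_sym pq setUAC.
have [|p [q [sE pqA tri]]] := get s; first by rewrite !inE eqxx.
have [|p' [q' [tE' pqA' tri']]] := get t; first by rewrite !inE eqxx orbT.
exists p, q, p', q'; split=> //; apply: contraNneq st => -[pE qE].
by rewrite sE tE' pE qE.
Qed.

End FourTriangles.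

(** * Orbits of permutations *)

Section OrbitTransport.

Variables (T T' : finType) (f : T -> T) (f' : T' -> T') (h : T' -> T).
Variable C : {set T'}.
Hypotheses (hI : injective h) (Cf : forall x, x \in C -> f' x \in C).
Hypothesis hom : forall x, x \in C -> f (h x) = h (f' x).

Lemma iter_closed k x : x \in C -> iter k f' x \in C.
Proof. by move=> xC; elim: k => //= k; apply: Cf. Qed.

Lemma iter_hom k x : x \in C -> iter k f (h x) = h (iter k f' x).
Proof. by move=> xC; elim: k => //= k ->; rewrite hom ?iter_closed. Qed.

Lemma fconnect_hom x y : x \in C -> fconnect f (h x) (h y) = fconnect f' x y.
Proof.
move=> xC; apply/idP/idP => [/iter_findex E|/iter_findex <-].
  by rewrite -(hI (etrans (esym (iter_hom _ xC)) E)) fconnect_iter.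
by rewrite -iter_hom ?fconnect_iter.
Qed.

Lemma order_hom x : x \in C -> fingraph.order f (h x) = fingraph.order f' x.
Proof.
move=> xC; rewrite /fingraph.order -(card_image hI); apply: eq_card => y.
apply/idP/imageP => [/iter_findex <-|[z xz ->]].
  by exists (iter (findex f (h x) y) f' x); rewrite ?iter_hom //; exact: fconnect_iter.
by rewrite -[_ \in _]/(fconnect f (h x) (h z)) fconnect_hom.
Qed.

(** On the closed set C the map h carries orbits to orbits. Commutation is asked for on C only,
    because the face permutations of a composition and of its factors agree only on the faces that
    survive. *)
Lemma fcard_hom : injective f -> injective f' ->
  fcard f (h @: C) = fcard f' C.
Proof.
move=> fI f'I; have cl : fclosed f (h @: C).
  apply: (intro_closed (fconnect_sym fI)) => _ _ /eqP <- /imsetP[x xC ->].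
  by rewrite hom // imset_f ?Cf.
rewrite (adjunction_n_comp h (fconnect_sym fI) (fconnect_sym f'I) cl).
  by apply: eq_n_comp_r => x; rewrite !inE mem_imset.
apply: (strict_adjunction (fconnect_sym f'I) cl hI).
  by apply/subsetP => _ /imsetP[x _ ->]; exact: codom_f.
move=> x y; rewrite !inE negbK mem_imset // => xC.
by rewrite /= hom // (inj_eq hI).
Qed.

End OrbitTransport.

Section Orders.
Variables (T : finType) (f : T -> T).
Hypothesis fI : injective f.

Lemma fcard_split (C : {set T}) : (forall x, x \in C -> f x \in C) ->
  fcard f T = fcard f C + fcard f (~: C).
Proof.
move=> cl; rewrite (n_compC (mem C)); congr (_ + _).
by apply: eq_n_comp_r => x; rewrite !inE.
Qed.

Lemma fcard_order (C : {set T}) n : 0 < n -> (forall x, x \in C -> f x \in C) ->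
  (forall x, x \in C -> fingraph.order f x = n) -> fcard f C * n = #|C|.
Proof.
move=> n0 cl ord; apply: fcard_order_set => //; first by apply/subsetP => x /ord xn; rewrite inE xn.
by apply: (intro_closed (fconnect_sym fI)) => x _ /eqP <-; exact: cl.
Qed.

Lemma fcardU (A B : {set T}) : [disjoint A & B] -> fcard f (A :|: B) = fcard f A + fcard f B.
Proof.
move=> AB; rewrite /n_comp_mem.
set a := [predI froots f & A]; set b := [predI froots f & B].
have ab : [disjoint a & b].
  rewrite disjoint_subset; apply/subsetP => x; rewrite !inE => /andP[_ xA].
  by rewrite (disjointFr AB xA) andbF.
move: (cardUI a b); rewrite [#|[predI a & b]|](eq_card0 (A := _)) ?addn0; last first.
  by move=> x; have /pred0P/(_ x) := ab.
by move=> <-; apply: eq_card => x; rewrite !inE andb_orr.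
Qed.

Lemma two_orbits x y (C : {set T}) : ~~ fconnect f x y ->
  (forall e, (e \in C) = ~~ fconnect f x e && ~~ fconnect f y e) ->
  fcard f T = fcard f C + 2.
Proof.
move=> xy CE.
pose X := [set e | fconnect f x e]; pose Y := [set e | fconnect f y e].
have XY : [disjoint X & Y].
  rewrite disjoint_subset; apply/subsetP => e; rewrite !inE => xe.
  apply: contra xy => ye; apply: connect_trans xe _.
  by rewrite fconnect_sym.
have CXY : C = ~: (X :|: Y) by apply/setP => e; rewrite CE !inE negb_or.
have fX z : fcard f [set e | fconnect f z e] = 1.
  rewrite -(n_comp_connect (fconnect_sym fI) z); apply: eq_n_comp_r => e.
  by rewrite inE.
rewrite (fcard_split (C := C)) => [|e]; last first.
  by rewrite !CE -!same_fconnect1_r.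
rewrite CXY setCK; congr (_ + _).
by rewrite fcardU // !fX.
Qed.

Lemma order3P x : fingraph.order f x = 3 ->
  (forall y, fconnect f x y = (y \in [:: x; f x; f (f x)])) /\ f (f (f x)) = x.
Proof.
move=> o3; split; last by have := iter_order fI x; rewrite o3.
by move=> y; rewrite fconnect_orbit /orbit o3.
Qed.
End Orders.

(** * Drawings of connected graphs *)

Definition connected (G : sgraph) := forall u v : G, connect (@adj G) u v.

Section Darts.

Variable G : sgraph.
Implicit Types (d : dart G) (r : {perm dart G}).

Definition tip d : G := (val d).2.

Lemma dart_inj d d' : tail d = tail d' -> tip d = tip d' -> d = d'.
Proof.
case: d d' => [[u v] uv] [[u' v'] uv']; rewrite /tail /tip /= => E1 E2.
by apply: val_inj; rewrite /= E1 E2.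
Qed.

Lemma dart_adj d : adj (tail d) (tip d).
Proof. exact: valP d. Qed.

Definition mk_dart (u v : G) (uv : adj u v) : dart G := exist (fun d : G * G => adj d.1 d.2) (u, v) uv.

Lemma tail_rev d : tail (dart_rev d) = tip d. Proof. by []. Qed.
Lemma tip_rev d : tip (dart_rev d) = tail d. Proof. by []. Qed.

Lemma dart_revK : involutive (@dart_rev G).
Proof. by move=> d; apply: dart_inj. Qed.

Lemma dart_rev_inj : injective (@dart_rev G).
Proof. exact: can_inj dart_revK. Qed.

Lemma face_step_inj r : injective (face_step r).
Proof. by move=> d d' /perm_inj/dart_rev_inj. Qed.

Lemma rotation_tail r d : rotation_system r -> tail (r d) = tail d.
Proof. by move=> rs; apply/eqP; rewrite -rs; exact: (mem_porbit r 1). Qed.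

Lemma porbit_fconnect r d d' : (d' \in porbit r d) = fconnect r d d'.
Proof.
apply/porbitP/idP => [[i ->]|/iter_findex <-]; first by rewrite permX fconnect_iter.
by exists (findex r d d'); rewrite permX.
Qed.

Lemma rotation_systemP r :
  (forall d, tail (r d) = tail d) ->
  (forall d d', tail d' = tail d -> fconnect r d d') -> rotation_system r.
Proof.
move=> rt rc d d'; rewrite porbit_fconnect; apply/idP/eqP => [/iter_findex <-|/rc //].
by elim: (findex _ _ _) => //= n; rewrite rt.
Qed.

Lemma rotation_connect r d d' : rotation_system r -> tail d' = tail d -> fconnect r d d'.
Proof. by move=> rs E; rewrite -porbit_fconnect rs E. Qed.

(* Twice the equation V + F = E + 2, as every edge gives two darts. *)
Definition spherical r :=
  rotation_system r /\ (#|G| + fcard (face_step r) {: dart G}).*2 = #|dart G| + 4.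

Lemma spherical_plane r : connected G -> 1 < #|G| -> spherical r -> plane_drawing r.
Proof.
move=> con G2 [rs E]; split=> //.
have niT : nonisolated G =i predT.
  move=> v; rewrite !inE; have /existsP[w vw] : [exists w, w != v].
    apply: contraLR G2; rewrite negb_exists -leqNgt => /forallP vP.
    apply/card_le1P => u _ w; rewrite inE.
    by have := vP u; have := vP w; rewrite !negbK => /eqP-> /eqP->; rewrite inE eqxx.
  case/connectP: (con v w) vw => -[|p s] /= => [_ ->|/andP[vp _] _]; first by rewrite eqxx.
  by move=> _; apply/existsP; exists p.
have [v] : {v : G | v \in G} by apply/sigW/card_gt0P; exact: ltnW.
move=> _; rewrite (eq_n_comp_r (a' := connect (@adj G) v)); last first.
  by move=> w; rewrite niT; apply/esym/con.
rewrite n_comp_connect; last exact: sym_connect_sym (@adj_sym G) .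
rewrite (eq_card niT); apply: double_inj; rewrite E doubleD.
(* The doubled equation makes the number of darts even, so halving it is exact. *)
have : odd #|dart G| = false.
  by have := congr1 odd E; rewrite odd_double oddD addbF.
by move=> ev; rewrite -[in LHS](odd_double_half #|dart G|) ev.
Qed.

(** The last clause, applied to a dart and its reverse, makes both faces at the middle edge of a
    diamond triangles. Later compositions delete such edges or split their ends, and need this to
    obtain merged faces of length 5. *)
Definition good_drawing r :=
  [/\ spherical r, forall d, face_length r d != 4 &
      forall d p q, cn2 (tail d) (tip d) p q -> face_length r d = 3].

End Darts.

Section DrawingIso.

Variables (G H : sgraph) (h : G -> H).
Hypotheses (bh : bijective h) (hadj : forall u v, adj (h u) (h v) = adj u v).

Lemma dart_iso_subproof (d : dart G) : adj (h (tail d)) (h (tip d)).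
Proof. by rewrite hadj dart_adj. Qed.

Definition dart_iso d : dart H := mk_dart (dart_iso_subproof d).

Lemma dart_iso_bij : bijective dart_iso.
Proof.
have [g hK gK] := bh.
have gadj (d : dart H) : adj (g (tail d)) (g (tip d)) by rewrite -hadj !gK dart_adj.
exists (fun d => mk_dart (gadj d)) => d; apply: dart_inj; rewrite /tail /tip /= ?hK ?gK //.
Qed.

Variable r : {perm dart H}.

(** The conjugated rotation is returned with its defining equation, since the drawing of the Moser
    spindle needs the explicit cyclic order at the centre. *)
Lemma drawing_iso : exists r' : {perm dart G},
  [/\ forall d, dart_iso (r' d) = r (dart_iso d),
      forall d, face_length r' d = face_length r (dart_iso d) &
      good_drawing r -> good_drawing r'].
Proof.
have [k iK kK] := dart_iso_bij; have iI := can_inj iK; have kI := can_inj kK.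
have fI : injective (fun d => k (r (dart_iso d))) by move=> d d' /kI/perm_inj/iI.
have rE d : dart_iso (perm fI d) = r (dart_iso d) by rewrite permE kK.
have tE d : tail (dart_iso d) = h (tail d) by [].
have fE d : dart_iso (face_step (perm fI) d) = face_step r (dart_iso d).
  by rewrite /face_step rE; congr (r _); apply: dart_inj.
have fE' d : d \in [set: dart G] -> face_step r (dart_iso d) = dart_iso (face_step (perm fI) d).
  by rewrite fE.
have cE : #|dart G| = #|dart H| by apply: bij_eq_card; exact: dart_iso_bij.
have lE d : face_length (perm fI) d = face_length r (dart_iso d).
  by rewrite /face_length (order_hom iI _ fE').
exists (perm fI); split=> // -[[rs E] n4 f3]; split=> [|d|d p q pq]; last 2 first.
- by rewrite lE.
- rewrite lE; apply: (f3 _ (h p) (h q)); move: pq; rewrite /cn2 /=.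
  by rewrite /tail /tip /= !hadj (inj_eq (bij_inj bh)).
split.
  apply: rotation_systemP => [d|d d' dd'].
    by apply: (bij_inj bh); rewrite -!tE rE rotation_tail.
  have rE' e : e \in [set: dart G] -> r (dart_iso e) = dart_iso (perm fI e) by rewrite rE.
  rewrite -(fconnect_hom iI _ rE') //.
  by apply: rotation_connect => //; rewrite !tE dd'.
rewrite cE -E (bij_eq_card bh); congr (_ + _).*2.
transitivity (fcard (face_step (perm fI)) [set: dart G]).
  by apply: eq_n_comp_r => d; rewrite !inE.
rewrite -(fcard_hom iI _ fE') //; try exact: face_step_inj.
apply: eq_n_comp_r => d; rewrite !inE; apply/imsetP; exists (k d) => //.
Qed.

Lemma good_drawing_iso : good_drawing r -> exists r' : {perm dart G}, good_drawing r'.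
Proof. by have [r' [_ _ rg]] := drawing_iso => /rg; exists r'. Qed.

End DrawingIso.

(** * Drawings given by lists of neighbours *)

Lemma order_traject (T : finType) (f : T -> T) x k : injective f ->
  iter k.+1 f x = x -> uniq (traject f x k.+1) -> fingraph.order f x = k.+1.
Proof.
move=> fI E U; rewrite (@order_cycle _ f (traject f x k.+1)) ?size_traject //.
  by rewrite /= -[X in rcons _ X]E iterSr -trajectSr fpath_traject.
by rewrite /= mem_head.
Qed.

(* Vertex u of the graph on {0, ..., n-1} has the neighbours rot u, in this cyclic order. *)
Section ListRotation.

Variables (n : nat) (rot : nat -> seq nat).

Definition list_graph_ok :=
  all (fun u => uniq (rot u) && all (fun v => [&& v < n, v != u & u \in rot v]) (rot u)) (iota 0 n).

Hypothesis ok : list_graph_ok.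

Lemma list_graph_okP (u : 'I_n) : uniq (rot u) /\
  forall v, v \in rot u -> [/\ v < n, v != u & val u \in rot v].
Proof.
have /allP/(_ (val u)) := ok; rewrite mem_iota /= => /(_ (ltn_ord u))/andP[-> /allP h].
by split=> // v /h/and3P.
Qed.

Definition list_adj (u v : 'I_n) := val v \in rot u.

Lemma list_adj_sym : symmetric list_adj.
Proof. by move=> u v; apply/idP/idP => /(list_graph_okP _).2[]. Qed.

Lemma list_adj_irr : irreflexive list_adj.
Proof. by move=> u; apply/negP => /(list_graph_okP _).2[_]; rewrite eqxx. Qed.

Definition list_graph : sgraph := SGraph list_adj_sym list_adj_irr.

Local Notation D := (dart list_graph).

Lemma list_next_subproof (d : D) : next (rot (val (tail d))) (val (tip d)) < n.
Proof.
have [_ rP] := list_graph_okP (tail d).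
by have [] := rP (next (rot (val (tail d))) (val (tip d))); rewrite // mem_next; exact: (dart_adj d).
Qed.

Lemma list_next_adj (d : D) : adj (tail d) (Ordinal (list_next_subproof d) : list_graph).
Proof. by rewrite /adj /= /list_adj /= mem_next; exact: (dart_adj d). Qed.

Definition list_next (d : D) : D := mk_dart (list_next_adj d).

Lemma list_next_inj : injective list_next.
Proof.
move=> d d' E.
have tE : tail d = tail d' by have := congr1 (@tail _) E.
apply: (dart_inj tE); apply: val_inj => /=.
have /= E2 : val (tip (list_next d)) = val (tip (list_next d')) by rewrite E.
rewrite -(prev_next (list_graph_okP (tail d)).1 (val (tip d))).
by rewrite E2 tE prev_next //; exact: (list_graph_okP _).1.
Qed.

Definition list_rotation : {perm D} := perm list_next_inj.

(** The face permutation on pairs of natural numbers, where it can be evaluated; the checks on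
    concrete graphs then run by computation. *)
Definition pair_step (p : nat * nat) := (p.2, next (rot p.2) p.1).

Definition pair_darts := [seq (u, v) | u <- iota 0 n, v <- rot u].

Definition face_len k p := (iter k pair_step p == p) && uniq (traject pair_step p k).

Definition transitive_ok := all (fun u => all (fun v => all (fun w =>
  has (fun k => iter k (next (rot u)) v == w) (iota 0 n)) (rot u)) (rot u)) (iota 0 n).

(** Faces are counted through their darts: if all lengths are 3 or 5, dividing the two classes of
    darts by 3 and 5 gives the number of faces. *)
Definition euler_ok := [&& all (fun p => face_len 3 p || face_len 5 p) pair_darts,
  3 %| count (face_len 3) pair_darts, 5 %| count (predC (face_len 3)) pair_darts &
  (n + (count (face_len 3) pair_darts %/ 3 + count (predC (face_len 3)) pair_darts %/ 5)).*2
   == size pair_darts + 4].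

Definition pair_of (d : D) : nat * nat := (val (tail d), val (tip d)).

Lemma pair_of_inj : injective pair_of.
Proof. by move=> d d' [/val_inj E1 /val_inj E2]; exact: dart_inj. Qed.

Lemma pair_of_step d : pair_of (face_step list_rotation d) = pair_step (pair_of d).
Proof. by rewrite /face_step permE. Qed.

Lemma pair_dartsP p : reflect (exists d, pair_of d = p) (p \in pair_darts).
Proof.
apply: (iffP allpairsPdep) => [[u [v [un vu ->]]]|[d <-]].
  rewrite mem_iota /= in un.
  have [_ /(_ _ vu)[vn _ _]] := list_graph_okP (Ordinal un).
  by exists (@mk_dart list_graph (Ordinal un) (Ordinal vn) vu).
exists (val (tail d)), (val (tip d)); split=> //; first by rewrite mem_iota /=; exact: ltn_ord.
exact: (dart_adj d).
Qed.

Lemma uniq_pair_darts : uniq pair_darts.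
Proof.
apply: allpairs_uniq_dep; first exact: iota_uniq.
  by move=> u; rewrite mem_iota /= => un; have [] := list_graph_okP (Ordinal un).
by move=> [u v] [u' v'] _ _ /= [-> ->].
Qed.

Lemma card_pair_darts (P : pred (nat * nat)) : #|[set d | P (pair_of d)]| = count P pair_darts.
Proof.
rewrite -size_filter cardE -(size_map pair_of); apply/eqP.
rewrite -uniq_size_uniq ?(map_inj_uniq pair_of_inj) ?enum_uniq ?filter_uniq ?uniq_pair_darts //.
move=> p; rewrite mem_filter; apply/andP/mapP => [[Pp /pair_dartsP[d dE]]|[d]].
  by exists d => //; rewrite mem_enum inE dE.
by rewrite mem_enum inE => Pd ->; split=> //; apply/pair_dartsP; exists d.
Qed.

Lemma face_len_order k d : face_len k.+1 (pair_of d) -> face_length list_rotation d = k.+1.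
Proof.
have iE i : pair_of (iter i (face_step list_rotation) d) = iter i pair_step (pair_of d).
  by elim: i => //= i <-; rewrite pair_of_step.
case/andP => /eqP E U; apply: order_traject; first exact: face_step_inj.
  by apply: pair_of_inj; rewrite iE.
rewrite -(map_inj_uniq pair_of_inj); congr uniq: U.
apply: (@eq_from_nth _ (pair_of d)); first by rewrite size_map !size_traject.
rewrite size_traject => i ik; rewrite nth_traject // (nth_map d) ?size_traject //.
by rewrite nth_traject // iE.
Qed.

Lemma list_rotation_system : transitive_ok -> rotation_system list_rotation.
Proof.
move=> tr; apply: rotation_systemP => [d|d d' dd']; first by rewrite permE.
have /allP/(_ (val (tail d))) := tr; rewrite mem_iota /= => /(_ (ltn_ord _)).
move/allP/(_ (val (tip d)) (dart_adj d))/allP/(_ (val (tip d'))).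
rewrite -{1}dd' => /(_ (dart_adj d'))/hasP[k _ /eqP kE].
suff <- : iter k list_rotation d = d' by exact: fconnect_iter.
apply: pair_of_inj; rewrite /pair_of dd' -kE.
by elim: k {kE} => //= k [IH1 IH2]; rewrite permE /= -IH2 IH1.
Qed.

Lemma list_face_length : euler_ok ->
  forall d, face_length list_rotation d = if face_len 3 (pair_of d) then 3 else 5.
Proof.
case/andP => /allP h _ d; have := h (pair_of d).
case: ifP => [l3 _|_]; first exact: face_len_order.
by move=> /(_ _)/face_len_order; apply; apply/pair_dartsP; exists d.
Qed.

Lemma list_spherical : transitive_ok -> euler_ok -> spherical list_rotation.
Proof.
move=> tr eu; split; first exact: list_rotation_system.
have fl := list_face_length eu; have fI := @face_step_inj _ list_rotation.
case/and4P: eu => _ d3 d5 /eqP E.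
pose C := [set d : D | face_len 3 (pair_of d)].
have CE d : (face_step list_rotation d \in C) = (d \in C).
  have /(congr1 (eq_op^~ 3)) : face_length list_rotation (face_step list_rotation d) = face_length list_rotation d.
    by apply: eq_card => e; rewrite -[LHS]/(fconnect _ _ _) -same_fconnect1.
  by rewrite !fl !inE; do 2!case: ifP.
rewrite card_ord (@fcard_split _ _ C) => [|d]; last by rewrite CE.
have -> : #|D| = size pair_darts.
  by rewrite -(count_predT pair_darts) -card_pair_darts; apply: eq_card => d; rewrite !inE.
rewrite -E; congr (_ + (_ + _)).*2.
  rewrite -card_pair_darts -(@fcard_order _ _ fI C 3) ?mulnK // => d dC; rewrite ?CE //.
  by have := fl d; rewrite inE in dC; rewrite dC.
have -> : count (predC (face_len 3)) pair_darts = #|~: C|.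
  by rewrite -card_pair_darts; apply: eq_card => d; rewrite !inE.
rewrite -(@fcard_order _ _ fI (~: C) 5) ?mulnK // => d; rewrite !in_setC ?CE //.
by move=> dC; have := fl d; rewrite inE in dC; rewrite (negPf dC).
Qed.

End ListRotation.

(** * Diamonds *)

(** The ends of the middle edge of a diamond have degree 3. K4 has this property and every
    Ore-composition inherits it; p and q may be adjacent. *)
Definition closed_diamonds (G : sgraph) :=
  forall u v p q w : G, cn2 u v p q -> adj u w -> w \in [:: v; p; q].

Lemma cn2C (G : sgraph) (u v p q : G) : cn2 u v p q -> cn2 v u p q.
Proof. by case/and5P=> uv pq up vp /andP[uq vq]; rewrite /cn2 adj_sym uv pq vp up vq uq. Qed.

Lemma closed_diamonds_iso (G H : sgraph) : isomorphic G H ->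
  closed_diamonds H -> closed_diamonds G.
Proof.
case=> h bh hadj dH u v p q w uv uw.
have := dH (h u) (h v) (h p) (h q) (h w).
rewrite /cn2 !hadj !inE !(inj_eq (bij_inj bh)); exact.
Qed.

Lemma closed_diamonds_K4 (G : sgraph) : isK4 G -> closed_diamonds G.
Proof.
move=> K u v p q w /and5P[uv pq up vp /andP[uq vq]] uw.
move: uv pq up vp uq vq uw; rewrite !K.2 => uv pq up vp uq vq uw.
have U : uniq [:: u; v; p; q] by rewrite /= !inE !negb_or uv up uq vp vq pq.
have : w \in [:: u; v; p; q].
  have /(uniq_min_size U) : {subset [:: u; v; p; q] <= enum G} by move=> t; rewrite mem_enum.
  by rewrite -cardE K.1 => /(_ isT)[_ ->]; rewrite mem_enum.
by rewrite in_cons eq_sym (negPf uw).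
Qed.

Section Structure.

Variables (G1 G2 : sgraph) (x y : G1) (z : G2) (A : {set G2}).
Hypotheses (xy : adj x y) (A0 : A != set0) (Az : A \proper neighbours z).
Hypotheses (D1 : closed_diamonds G1) (D2 : closed_diamonds G2).

Local Notation O := (ore_composition x y z A).
Local Notation lft a := (inl a : O).
Local Notation rgt w := (inr w : O).

(** If u were x, then y would be one of its only neighbours v, p, q in G1; but these are still
    adjacent to u in the composition, where xy is missing. So the middle edge avoids x and y. *)
Lemma ore_cn2_left u v (p q : O) : cn2 (lft u) (lft v) p q ->
  exists p' q', [/\ p = lft p', q = lft q', cn2 u v p' q', (u != x) && (u != y) & (v != x) && (v != y)].
Proof.
case/and5P; case: p => [p|p]; last by move=> uv _ up vp; case: (no_mixed uv up vp).
case: q => [q|q]; last by move=> uv _ _ _ /andP[uq vq]; case: (no_mixed uv uq vq).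
rewrite (inj_eq inl_inj) => uv pq up vp /andP[uq vq].
have c : cn2 u v p q.
  by move: uv up vp uq vq; rewrite /cn2 pq !ore_adj_ll; do 5!case/and3P=> -> _ _.
have key s t : adj (lft s) (lft t) -> adj (lft s) (lft p) -> adj (lft s) (lft q) -> cn2 s t p q ->
    (s != x) && (s != y).
  move=> st sp sq ct; apply/andP; split; apply/eqP => E; subst s.
    by have := D1 ct xy; rewrite !inE => /or3P[] /eqP E; move: st sp sq; rewrite -E ore_adj_xy.
  have yx : adj y x by rewrite adj_sym.
  by have := D1 ct yx; rewrite !inE => /or3P[] /eqP E; move: st sp sq; rewrite -E ore_adj_yx.
exists p, q; split=> //; first exact: key uv up uq c.
by apply: key vp vq (cn2C c); rewrite adj_sym.
Qed.

Lemma ore_cn2_right v w (p q : O) : cn2 (rgt v) (rgt w) p q ->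
  cn2 (val v) (val w) (ore_proj p) (ore_proj q).
Proof.
case/and5P=> vw pq vp wp /andP[vq wq].
rewrite /cn2 (inr_adj_proj vp) (inr_adj_proj wp) (inr_adj_proj vq) (inr_adj_proj wq).
rewrite (inr_adj_proj vw) /= andbT; apply: contraNneq pq => /(ore_proj_inj vp vq) ->.
by rewrite eqxx.
Qed.

(** Such a diamond would project to one with middle edge zw in G2. Then w, p and q are all the
    neighbours of z, and all are attached to u, so z would not be split. *)
Lemma ore_cn2_mixed u w (p q : O) : ~ cn2 (lft u) (rgt w) p q.
Proof.
have pR s : adj (lft u) (rgt w) -> adj (lft u) s -> adj (rgt w) s ->
    exists2 s', s = rgt s' & adj z (val s') /\ u = attach x y A (val s').
  case: s => [s|s] uw us ws; last first.
    by exists s => //; move: us; rewrite ore_adj_lr => /andP[-> /eqP].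
  by case: (no_mixed us uw); rewrite adj_sym.
case/and5P=> uw pq up wp /andP[uq wq].
have [p' pE [zp Ep]] := pR _ uw up wp; have [q' qE [zq Eq]] := pR _ uw uq wq.
have [zw Ew] : adj z (val w) /\ u = attach x y A (val w).
  by move: uw; rewrite ore_adj_lr => /andP[-> /eqP].
subst p q; have c : cn2 z (val w) (val p') (val q').
  have wp' : adj (val w) (val p') by exact: wp.
  have wq' : adj (val w) (val q') by exact: wq.
  by rewrite /cn2 zw zp zq wp' wq'; move: pq; rewrite (inj_eq inr_inj) -(inj_eq val_inj) => ->.
have att v : adj z v -> u = attach x y A v.
  by move=> zv; have := D2 c zv; rewrite !inE => /or3P[] /eqP ->.
have [AN [e eN eA]] := properP Az; have [f fA] := set0Pn _ A0.
have ex : u = x.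
  by rewrite (att f) /attach ?fA //; have := subsetP AN f fA; rewrite inE.
have ey : u = y.
  by rewrite (att e) /attach ?(negPf eA) //; move: eN; rewrite inE.
by move: xy; rewrite -ex -ey adj_irr.
Qed.

Lemma ore_closed_diamonds : closed_diamonds O.
Proof.
move=> [u|u] [v|v] p q w c uw.
- have [p' [q' [pE qE c' /andP[ux uy] _]]] := ore_cn2_left c.
  case: w uw => [w|w]; last first.
    rewrite ore_adj_lr /attach => /andP[_].
    by case: ifP => _; rewrite ?(negPf ux) ?(negPf uy).
  rewrite ore_adj_ll pE qE => /and3P[uw _ _].
  by have := D1 c' uw; rewrite !inE !(inj_eq inl_inj).
- by case: (ore_cn2_mixed c).
- by case: (ore_cn2_mixed (cn2C c)).
have := D2 (ore_cn2_right c) (inr_adj_proj uw).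
case/and5P: c => uv _ up _ /andP[uq _].
rewrite !inE => /or3P[] /eqP E; apply/or3P.
- by apply: Or31; apply/eqP/(ore_proj_inj uw uv).
- by apply: Or32; apply/eqP/(ore_proj_inj uw up).
- by apply: Or33; apply/eqP/(ore_proj_inj uw uq).
Qed.

End Structure.

(** * Drawing an Ore-composition *)

Section Surgery.

Variables (G1 G2 : sgraph) (x y : G1) (z : G2) (A : {set G2}).
Hypothesis xy : adj x y.

Local Notation O := (ore_composition x y z A).
Local Notation lft a := (inl a : O).
Local Notation rgt w := (inr w : O).
Local Notation att := (attach x y A).

Lemma attach_xy w : (att w == x) = (w \in A).
Proof.
rewrite /attach; case: ifP => _; rewrite ?eqxx //.
by apply/negbTE; rewrite eq_sym; exact: adj_neq.
Qed.

(* The copy of u from which the dart from u to w leaves; it depends on w if u = z. *)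
Definition place (u w : G2) : O := if insub u is Some u' then rgt u' else lft (att w).

Lemma place_z w : place z w = lft (att w).
Proof. by rewrite /place insubF ?eqxx. Qed.

Lemma place_neq u w (uz : u != z) : place u w = rgt (exist _ u uz).
Proof. by rewrite /place insubT. Qed.

Lemma place_proj u w : ore_proj (place u w) = u.
Proof.
by have [->|uz] := eqVneq u z; [rewrite place_z|rewrite place_neq].
Qed.

Lemma place_adj (d : dart G2) : adj (place (tail d) (tip d)) (place (tip d) (tail d)).
Proof.
have := dart_adj d; set u := tail d; set w := tip d => uw.
have [uz|uz] := eqVneq u z; have [wz|wz] := eqVneq w z.
- by have := adj_neq uw; rewrite uz wz eqxx.
- by rewrite uz place_z place_neq ore_adj_lr /= eqxx -uz uw.
- by rewrite wz place_z place_neq ore_adj_rl /= eqxx -wz adj_sym uw.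
- by rewrite !place_neq.
Qed.

Definition i2 (d : dart G2) : dart O := mk_dart (place_adj d).

Lemma i2_inj : injective i2.
Proof.
move=> d d' E; apply: dart_inj.
  by have := congr1 (fun e => ore_proj (tail e)) E; rewrite /= !place_proj.
by have := congr1 (fun e => ore_proj (tip e)) E; rewrite /= !place_proj.
Qed.

Lemma i2_rev d : dart_rev (i2 d) = i2 (dart_rev d).
Proof. by apply: dart_inj. Qed.

Definition dxy : dart G1 := mk_dart xy.
Definition dyx : dart G1 := dart_rev dxy.

Variables (r1 : {perm dart G1}) (r2 : {perm dart G2}) (alpha beta : dart G2).

Hypotheses (rs1 : rotation_system r1) (rs2 : rotation_system r2).
Hypotheses (r1x : r1 dxy != dxy) (r1y : r1 dyx != dyx).
Hypotheses (ta : tail alpha = z) (tb : tail beta = z).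
Hypotheses (aA : tip alpha \in A) (bA : tip beta \notin A).
(* Around z, the darts to A and those to the other neighbours form two
   intervals, starting at alpha and beta. *)
Hypothesis blocks : forall d, tail d = z ->
  (tip (r2 d) \in A) = (tip d \in A) (+) (r2 d \in [:: alpha; beta]).

(* The deleted darts xy and yx stand for alpha and beta, the first darts of the
   two blocks of darts that replace them in the rotations at x and y. *)
Definition i1 (d : dart G1) : dart O :=
  insubd (if d == dyx then i2 beta else i2 alpha) (lft (tail d), lft (tip d)).

Lemma dart_G1_neq d : d != dxy -> d != dyx -> adj (lft (tail d)) (lft (tip d)).
Proof.
move=> dx dy; rewrite ore_adj_ll dart_adj /=; apply/andP; split.
  by apply: contra dx => /eqP[E1 E2]; apply/eqP/dart_inj.
by apply: contra dy => /eqP[E1 E2]; apply/eqP/dart_inj.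
Qed.

Lemma dxy_neq_dyx : dxy != dyx.
Proof. by apply/eqP => /(congr1 (@tail _)) E; move: (adj_neq xy); rewrite [x]E eqxx. Qed.

Lemma i1E d (dx : d != dxy) (dy : d != dyx) : i1 d = mk_dart (dart_G1_neq dx dy).
Proof. by apply: val_inj; rewrite /i1 insubdK //; exact: dart_G1_neq. Qed.

Lemma i1_xy : i1 dxy = i2 alpha.
Proof.
rewrite /i1 (negPf dxy_neq_dyx) /insubd insubF //.
exact: ore_adj_xy.
Qed.

Lemma i1_yx : i1 dyx = i2 beta.
Proof. by rewrite /i1 eqxx /insubd insubF //; exact: ore_adj_yx. Qed.

Lemma alpha_neq_beta : alpha != beta.
Proof. by apply: contraNneq bA => <-. Qed.

Lemma i1_neq_i2 d e : d != dxy -> d != dyx -> i1 d != i2 e.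
Proof.
move=> dx dy; rewrite (i1E dx dy); apply/eqP => E.
have := congr1 (@tail _) E; have := congr1 (@tip _) E; rewrite /tail /tip /=.
have [ez|ez] := eqVneq (tip e) z; have [tz|tz] := eqVneq (tail e) z.
- by have := adj_neq (dart_adj e); rewrite ez tz eqxx.
- by rewrite [place (val e).1 _](place_neq _ tz).
- by rewrite [place (val e).2 _](place_neq _ ez).
- by rewrite [place (val e).2 _](place_neq _ ez).
Qed.

Lemma i2_eq_i1 d e : d \notin [:: dxy; dyx] -> (i2 e == i1 d) = false.
Proof.
by rewrite !inE negb_or => /andP[dx dy]; rewrite eq_sym (negPf (i1_neq_i2 e dx dy)).
Qed.

Lemma tail_i1 d : tail (i1 d) = lft (tail d).
Proof.
have [->|dx] := eqVneq d dxy.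
  by rewrite i1_xy /tail /= -/(tail _) ta place_z /attach -/(tip _) aA.
have [->|dy] := eqVneq d dyx.
  by rewrite i1_yx /tail /= -/(tail _) tb place_z /attach -/(tip _) (negPf bA).
by rewrite (i1E dx dy).
Qed.

Lemma i1_inj : injective i1.
Proof.
have key d d' : d != dxy -> d != dyx -> i1 d = i1 d' -> d = d'.
  move=> dx dy E; have [dE|dx'] := eqVneq d' dxy.
    by have := i1_neq_i2 alpha dx dy; rewrite E dE i1_xy eqxx.
  have [dE|dy'] := eqVneq d' dyx.
    by have := i1_neq_i2 beta dx dy; rewrite E dE i1_yx eqxx.
  have Et := congr1 (@tail _) E; have Eh := congr1 (@tip _) E.
  move: Et Eh; rewrite (i1E dx dy) (i1E dx' dy') /tail /tip /= => -[Et] [Eh].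
  exact: dart_inj.
move=> d d' E.
have [dE|dx] := eqVneq d dxy.
  have [dE'|dx'] := eqVneq d' dxy; first by rewrite dE dE'.
  have [dE'|dy'] := eqVneq d' dyx; last exact/esym/key.
  by move: E; rewrite dE dE' i1_xy i1_yx => /i2_inj/eqP; rewrite (negPf alpha_neq_beta).
have [dE|dy] := eqVneq d dyx; last exact: key.
have [dE'|dx'] := eqVneq d' dxy.
  by move: E; rewrite dE dE' i1_xy i1_yx => /i2_inj/esym/eqP; rewrite (negPf alpha_neq_beta).
have [dE'|dy'] := eqVneq d' dyx; first by rewrite dE dE'.
exact/esym/key.
Qed.

Lemma i1_rev d : d != dxy -> d != dyx -> dart_rev (i1 d) = i1 (dart_rev d).
Proof.
move=> dx dy.
have dx' : dart_rev d != dxy by rewrite -(inj_eq (@dart_rev_inj _)) dart_revK.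
have dy' : dart_rev d != dyx by rewrite (inj_eq (@dart_rev_inj _)).
by rewrite (i1E dx dy) (i1E dx' dy'); apply: dart_inj.
Qed.

Lemma dart_O_cases (e : dart O) :
  (exists2 d, (d != dxy) && (d != dyx) & e = i1 d) \/ (exists d, e = i2 d).
Proof.
case: e => -[[u|u] [v|v]] uv.
- left; have /and3P[auv nx ny] : [&& adj u v, (u, v) != (x, y) & (u, v) != (y, x)].
    by rewrite -(@ore_adj_ll _ _ x y z A).
  have dx : mk_dart auv != dxy by apply: contra nx => /eqP/(congr1 val)/= ->.
  have dy : mk_dart auv != dyx by apply: contra ny => /eqP/(congr1 val)/= ->.
  by exists (mk_dart auv); rewrite ?dx // (i1E dx dy); apply: val_inj.
- right; have /andP[zv /eqP uE] : adj z (val v) && (u == att (val v)).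
    by rewrite -ore_adj_lr.
  exists (mk_dart zv); apply: val_inj; rewrite /= place_z uE /place.
  by rewrite valK.
- right; have /andP[zu /eqP vE] : adj z (val u) && (v == att (val u)).
    by rewrite -ore_adj_rl.
  have uz : adj (val u) z by rewrite adj_sym.
  exists (mk_dart uz); apply: val_inj; rewrite /= place_z vE /place.
  by rewrite valK.
- right; exists (@mk_dart G2 (val u) (val v) uv); apply: val_inj => /=.
  by rewrite /place !valK.
Qed.

(** After the last dart of the block of [beta], which replaces yx at y, the rotation of G2 would
    return to [alpha]; instead the rotation at y continues with the successor of yx. The other case
    is the same at x. *)
Definition jump (d : dart G2) : dart O :=
  if r2 d == alpha then i1 (r1 dyx) else if r2 d == beta then i1 (r1 dxy) else i2 (r2 d).

Lemma rotation_exists : exists R : {perm dart O},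
  (forall d, d != dxy -> d != dyx -> R (i1 d) = i1 (r1 d)) /\ forall d, R (i2 d) = jump d.
Proof.
pose f (e : dart O) : dart O :=
  if [pick d | (d != dxy) && (d != dyx) && (i1 d == e)] is Some d then i1 (r1 d)
  else if [pick d | i2 d == e] is Some d then jump d else e.
have f1 d : d != dxy -> d != dyx -> f (i1 d) = i1 (r1 d).
  move=> dx dy; rewrite /f; case: pickP => [d' /andP[_ /eqP/i1_inj -> //]|/(_ d)].
  by rewrite dx dy eqxx.
have f2 d : f (i2 d) = jump d.
  rewrite /f; case: pickP => [d' /andP[/andP[dx dy]]|_].
    by rewrite (negPf (i1_neq_i2 _ dx dy)).
  by case: pickP => [d' /eqP/i2_inj -> //|/(_ d)]; rewrite eqxx.
(* On a finite type surjectivity is enough. The shared darts [i2 alpha] and [i2 beta] are reached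
   from the predecessors of xy and yx under [r1], which are not deleted darts because [r1] fixes
   neither xy nor yx. *)
have surj e : exists e', f e' == e.
  case: (dart_O_cases e) => [[d /andP[dx dy] ->]|[d ->]].
    have rK := permKV r1 d; set d1 := r1^-1%g d in rK.
    have [E|dx1] := eqVneq d1 dxy.
      exists (i2 (r2^-1%g beta)); rewrite f2 /jump permKV eqxx -rK E.
      by rewrite [beta == _]eq_sym (negPf alpha_neq_beta).
    have [E|dy1] := eqVneq d1 dyx.
      by exists (i2 (r2^-1%g alpha)); rewrite f2 /jump permKV eqxx -rK E.
    by exists (i1 d1); rewrite f1 // rK.
  have case1 d0 : (d0 == dxy) || (d0 == dyx) -> exists e', f e' == i1 d0.
    move=> d0E; have rK := permKV r1 d0; set d1 := r1^-1%g d0 in rK.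
    have td1 : tail d1 = tail d0 by rewrite -rK rotation_tail.
    exists (i1 d1); rewrite f1 ?rK //.
      apply/eqP => E; case/orP: d0E => /eqP E0; first by move: r1x; rewrite -{1}E rK E0 eqxx.
      by move: td1; rewrite E E0 => Et; have := adj_neq xy; rewrite [x]Et eqxx.
    apply/eqP => E; case/orP: d0E => /eqP E0; last by move: r1y; rewrite -{1}E rK E0 eqxx.
    by move: td1; rewrite E E0 => Et; have := adj_neq xy; rewrite -[x]Et eqxx.
  have [->|da] := eqVneq d alpha; first by rewrite -i1_xy; apply: case1; rewrite eqxx.
  have [->|db] := eqVneq d beta; first by rewrite -i1_yx; apply: case1; rewrite eqxx orbT.
  by exists (i2 (r2^-1%g d)); rewrite f2 /jump permKV (negPf da) (negPf db).
have [g gP] : exists g, forall e, f (g e) = e.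
  by have [g gP] := fin_all_exists surj; exists g => e; apply/eqP.
have fI : injective f by exact: can_inj (canF_sym gP).
by exists (perm fI); split=> [d dx dy|d]; rewrite permE ?f1 ?f2.
Qed.


Variable R : {perm dart O}.
Hypotheses (R1 : forall d, d != dxy -> d != dyx -> R (i1 d) = i1 (r1 d)).
Hypotheses (R2 : forall d, R (i2 d) = jump d).

Lemma z_class d : tail d = z -> place (tail d) (tip d) = lft (if tip d \in A then x else y).
Proof. by move=> ->; rewrite place_z. Qed.

Lemma R_tail e : tail (R e) = tail e.
Proof.
have [[d /andP[dx dy] ->]|[d ->]] := dart_O_cases e.
  by rewrite R1 // !tail_i1 rotation_tail.
rewrite R2 /jump; have td := rotation_tail d rs2.
case: eqP => [E|/eqP Na].
  have dz : tail d = z by rewrite -td E.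
  have := blocks dz; rewrite E inE eqxx aA addbT => /esym/negPf dA.
  by rewrite tail_i1 rotation_tail // [in RHS]/tail /= z_class // dA.
case: eqP => [E|/eqP Nb].
  have dz : tail d = z by rewrite -td E.
  have := blocks dz; rewrite E !inE eqxx orbT (negPf bA) addbT => /esym/negbFE dA.
  by rewrite tail_i1 rotation_tail // [in RHS]/tail /= z_class // dA.
rewrite /tail /= -!/(tail _) -!/(tip _) td.
have [dz|dz] := eqVneq (tail d) z; last by rewrite !place_neq.
rewrite dz !place_z /attach; congr (inl (if _ then _ else _)).
by rewrite blocks // !inE (negPf Na) (negPf Nb) addbF.
Qed.

Let fR := fconnect R.

Lemma fR_sym e e' : fR e e' = fR e' e.
Proof. exact: fconnect_sym perm_inj _ _. Qed.

Lemma fR_trans e e' e'' : fR e e' -> fR e' e'' -> fR e e''.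
Proof. exact: connect_trans. Qed.

Lemma fR_step2 d : r2 d \notin [:: alpha; beta] -> fR (i2 d) (i2 (r2 d)).
Proof.
rewrite !inE negb_or => /andP[/negPf Na /negPf Nb].
have := fconnect1 R (i2 d); rewrite R2 /jump Na Nb; exact.
Qed.

(** Going around z from [alpha], the rotation of the composition follows [r2] inside a block, and
    the claim starts afresh whenever [alpha] or [beta] is met. *)
Lemma fR_block d : tail d = z -> fR (if tip d \in A then i2 alpha else i2 beta) (i2 d).
Proof.
move=> dz; have /iter_findex <- : fconnect r2 alpha d by apply: rotation_connect; rewrite ?ta.
elim: (findex _ _ _) => [|k IH] /=; first by rewrite aA; exact: connect0.
set e := iter k r2 alpha in IH *.
have ez : tail e = z.
  by rewrite /e; elim: k {IH e} => //= k <-; rewrite rotation_tail.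
have [re|re] := boolP (r2 e \in [:: alpha; beta]).
  move: re; rewrite !inE => /orP[] /eqP ->; first by rewrite aA; exact: connect0.
  by rewrite (negPf bA); exact: connect0.
by rewrite blocks // (negPf re) addbF; apply: fR_trans IH (fR_step2 re).
Qed.

(** From a deleted dart one step of [r1] becomes a walk through the whole block that replaces this
    dart. *)
Lemma fR_step1 d : fR (i1 d) (i1 (r1 d)).
Proof.
have [->|dx] := eqVneq d dxy.
  rewrite i1_xy; set e := r2^-1%g beta.
  have eb : r2 e = beta by rewrite permKV.
  have ez : tail e = z by rewrite -(rotation_tail e rs2) eb.
  have := blocks ez; rewrite eb !inE eqxx orbT addbT (negPf bA) => /esym/negbFE eA.
  have := fR_block ez; rewrite eA => /fR_trans; apply.
  have := fconnect1 R (i2 e); rewrite R2 /jump eb eqxx.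
  by rewrite [beta == _]eq_sym (negPf alpha_neq_beta).
have [->|dy] := eqVneq d dyx.
  rewrite i1_yx; set e := r2^-1%g alpha.
  have eb : r2 e = alpha by rewrite permKV.
  have ez : tail e = z by rewrite -(rotation_tail e rs2) eb.
  have := blocks ez; rewrite eb !inE eqxx addbT aA => /esym/negPf eA.
  have := fR_block ez; rewrite eA => /fR_trans; apply.
  by have := fconnect1 R (i2 e); rewrite R2 /jump eb eqxx.
by have := fconnect1 R (i1 d); rewrite R1.
Qed.

Lemma fR_i1 d d' : tail d' = tail d -> fR (i1 d) (i1 d').
Proof.
move=> /(rotation_connect rs1)/iter_findex <-.
elim: (findex _ _ _) => [|k IH]; first exact: connect0.
exact: fR_trans IH (fR_step1 _).
Qed.

Lemma fR_left (e : dart O) u : tail e = lft u -> exists2 d, tail d = u & fR (i1 d) e.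
Proof.
have [[d _ ->]|[d ->]] := dart_O_cases e.
  by rewrite tail_i1 => -[E]; exists d => //; exact: connect0.
move=> E; have dz : tail d = z.
  by rewrite -(place_proj (tail d) (tip d)) -[place _ _]/(tail (i2 d)) E.
have := fR_block dz; move: E; rewrite /tail /= -/(tail _) -/(tip _) z_class // => -[<-].
by case: ifP => _ H; [exists dxy|exists dyx]; rewrite ?i1_xy ?i1_yx.
Qed.

Lemma R_rotation : rotation_system R.
Proof.
apply: rotation_systemP => [e|e e']; first exact: R_tail.
case E: (tail e) => [u|w] E'.
  have [d dt de] := fR_left E; have [d' dt' de'] := fR_left E'.
  apply: fR_trans (de'); rewrite -/fR -/(fR _ _) fR_sym in de.
  by apply: fR_trans de (fR_i1 _); rewrite dt.
have get (c : dart O) : tail c = rgt w -> exists2 d, tail d = val w & c = i2 d.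
  have [[d _ ->]|[d ->]] := dart_O_cases c; first by rewrite tail_i1.
  move=> E0; exists d => //.
  by rewrite -(place_proj (tail d) (tip d)) -[place _ _]/(tail (i2 d)) E0.
have [d dt ->] := get _ E; have [d' dt' ->] := get _ E'.
have : fconnect r2 d d' by apply: rotation_connect; rewrite ?dt.
move/iter_findex <-; elim: (findex _ _ _) => [|k IH]; first exact: connect0.
apply: fR_trans IH (fR_step2 _); apply: contra (valP w).
rewrite -dt; set e0 := iter k _ _ => eE.
have <- : tail (r2 e0) = tail d.
  by rewrite rotation_tail // /e0; elim: k {e0 eE} => //= k <-; rewrite rotation_tail.
by move: eE; rewrite !inE => /orP[] /eqP ->; rewrite ?ta ?tb.
Qed.


Local Notation phi := (face_step R).
Local Notation phi1 := (face_step r1).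
Local Notation phi2 := (face_step r2).

Hypotheses (len_xy : face_length r1 dxy = 3) (len_yx : face_length r1 dyx = 3).
Hypotheses (len_a : face_length r2 alpha = 3) (len_b : face_length r2 beta = 3).

Lemma phi_i1 d : d != dxy -> d != dyx -> phi (i1 d) = i1 (phi1 d).
Proof.
move=> dx dy; rewrite /face_step i1_rev // R1 //.
  by rewrite -(inj_eq (@dart_rev_inj _)) dart_revK.
by rewrite (inj_eq (@dart_rev_inj _)).
Qed.

Lemma phi_i2 d : phi (i2 d) =
  if phi2 d == alpha then i1 (phi1 dxy) else if phi2 d == beta then i1 (phi1 dyx) else i2 (phi2 d).
Proof. by rewrite /face_step i2_rev R2 /jump dart_revK. Qed.

Lemma phi1_uniq p : face_length r1 p = 3 -> uniq [:: p; phi1 p; phi1 (phi1 p)].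
Proof.
by move=> lp; have := orbit_uniq phi1 p; rewrite /orbit -/(face_length r1 p) lp.
Qed.

Lemma phi1_xy : (phi1 dxy \notin [:: dxy; dyx]) && (phi1 (phi1 dxy) \notin [:: dxy; dyx]).
Proof.
have [_ c3] := order3P (@face_step_inj _ r1) len_xy.
have := phi1_uniq len_xy; rewrite /= !inE !negb_or => /and3P[/andP[n1 n2] _ _].
rewrite [_ == dxy]eq_sym n1 [_ == dxy]eq_sym n2 r1y /=.
by apply: contraNneq r1x => E; rewrite -{2}c3 E /face_step dart_revK.
Qed.

Lemma phi1_yx : (phi1 dyx \notin [:: dxy; dyx]) && (phi1 (phi1 dyx) \notin [:: dxy; dyx]).
Proof.
have [_ c3] := order3P (@face_step_inj _ r1) len_yx.
have := phi1_uniq len_yx; rewrite /= !inE !negb_or => /and3P[/andP[n1 n2] _ _].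
rewrite [_ == dyx]eq_sym n1 [_ == dyx]eq_sym n2 {1}/face_step dart_revK r1x /= andbT.
by apply: contraNneq r1y => E; rewrite -{2}c3 E.
Qed.

Lemma phi2_z a : face_length r2 a = 3 -> tail a = z ->
  (phi2 a \notin [:: alpha; beta]) && (phi2 (phi2 a) \notin [:: alpha; beta]).
Proof.
move=> la az; have [_ c3] := order3P (@face_step_inj _ r2) la.
have tphi d : tail (phi2 d) = tip d by rewrite rotation_tail.
have nz d : tail d != z -> d \notin [:: alpha; beta].
  by apply: contra; rewrite !inE => /orP[] /eqP ->; apply/eqP.
rewrite !nz //; last by rewrite tphi -az; apply: contraTneq (dart_adj a) => ->; rewrite adj_irr.
have <- : tip (phi2 (phi2 a)) = z by rewrite -tphi c3.
exact: adj_neq (dart_adj _).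
Qed.

(* The triangular faces of xy and alpha (or of yx and beta) are joined, losing xy. *)
Lemma five_face p a : i1 p = i2 a -> tail a = z ->
  face_length r1 p = 3 -> face_length r2 a = 3 ->
  (phi1 p \notin [:: dxy; dyx]) && (phi1 (phi1 p) \notin [:: dxy; dyx]) ->
  (forall d, phi2 d = a -> phi (i2 d) = i1 (phi1 p)) ->
  fingraph.order phi (i2 a) = 5 /\
  forall e, fconnect phi (i2 a) e =
    (e \in [:: i2 a; i2 (phi2 a); i2 (phi2 (phi2 a)); i1 (phi1 p); i1 (phi1 (phi1 p))]).
Proof.
move=> pa az lp la /andP[]; rewrite !inE !negb_or => /andP[p1x p1y] /andP[p2x p2y] jp.
have /andP[] := phi2_z la az; rewrite !inE !negb_or => /andP[/negPf a1a /negPf a1b] /andP[/negPf a2a /negPf a2b].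
have [_ p3] := order3P (@face_step_inj _ r1) lp.
have [_ a3] := order3P (@face_step_inj _ r2) la.
set s := [:: _, _ , _ , _ & _].
have cyc : fcycle phi s.
  rewrite /= phi_i2 a1a a1b eqxx phi_i2 a2a a2b eqxx jp // eqxx phi_i1 // eqxx phi_i1 // p3 pa.
  by rewrite eqxx.
have := phi1_uniq lp; rewrite /= !inE !negb_or => /and3P[_ p12 _].
have := orbit_uniq phi2 a; rewrite /orbit -/(face_length r2 a) la /= !inE !negb_or => /and3P[/andP[a01 a02] a12 _].
have us : uniq s.
  rewrite /= !inE !negb_or !(inj_eq i2_inj) (inj_eq i1_inj) a01 a02 a12 p12 /=.
  by rewrite ![i2 _ == i1 _]eq_sym !i1_neq_i2.
split; first by rewrite (order_cycle cyc us) // mem_head.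
by move=> e; rewrite (fconnect_cycle cyc) // mem_head.
Qed.

Lemma five_alpha : fingraph.order phi (i2 alpha) = 5 /\
  forall e, fconnect phi (i2 alpha) e = (e \in [:: i2 alpha; i2 (phi2 alpha); i2 (phi2 (phi2 alpha));
    i1 (phi1 dxy); i1 (phi1 (phi1 dxy))]).
Proof.
apply: five_face => //; [exact: i1_xy|exact: phi1_xy|].
by move=> d E; rewrite phi_i2 E eqxx.
Qed.

Lemma five_beta : fingraph.order phi (i2 beta) = 5 /\
  forall e, fconnect phi (i2 beta) e = (e \in [:: i2 beta; i2 (phi2 beta); i2 (phi2 (phi2 beta));
    i1 (phi1 dyx); i1 (phi1 (phi1 dyx))]).
Proof.
apply: five_face => //; [exact: i1_yx|exact: phi1_yx|].
by move=> d E; rewrite phi_i2 E [beta == _]eq_sym (negPf alpha_neq_beta) eqxx.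
Qed.

Definition kept1 := [set d | ~~ fconnect phi1 dxy d && ~~ fconnect phi1 dyx d].
Definition kept2 := [set d | ~~ fconnect phi2 alpha d && ~~ fconnect phi2 beta d].

Lemma kept1_neq d : d \in kept1 -> (d != dxy) && (d != dyx).
Proof.
rewrite inE => /andP[n1 n2]; apply/andP; split.
  by apply: contraNneq n1 => ->; exact: connect0.
by apply: contraNneq n2 => ->; exact: connect0.
Qed.

Lemma kept1_phi d : d \in kept1 -> phi1 d \in kept1.
Proof. by rewrite !inE -!same_fconnect1_r //; exact: face_step_inj. Qed.

Lemma kept2_phi d : d \in kept2 -> phi2 d \in kept2.
Proof. by rewrite !inE -!same_fconnect1_r //; exact: face_step_inj. Qed.

Lemma kept1_hom d : d \in kept1 -> phi (i1 d) = i1 (phi1 d).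
Proof. by move=> /kept1_neq/andP[? ?]; exact: phi_i1. Qed.

Lemma kept2_hom d : d \in kept2 -> phi (i2 d) = i2 (phi2 d).
Proof.
move=> dk; have := kept2_phi dk; rewrite phi_i2 inE => /andP[n1 n2].
case: eqP => [E|_]; first by rewrite E connect0 in n1.
by case: eqP => [E|_]; first by rewrite E connect0 in n2.
Qed.

Definition kept := (i1 @: kept1) :|: (i2 @: kept2).

Lemma separate1 : ~~ fconnect phi1 dxy dyx.
Proof.
have [-> _] := order3P (@face_step_inj _ r1) len_xy.
have := phi1_xy; rewrite !inE !negb_or [dyx == dxy]eq_sym dxy_neq_dyx.
by rewrite -!andbA => /and4P[_ n1 _ n2]; rewrite ![dyx == _]eq_sym n1 n2.
Qed.

Lemma separate2 : ~~ fconnect phi2 alpha beta.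
Proof.
have [-> _] := order3P (@face_step_inj _ r2) len_a.
have := phi2_z len_a ta; rewrite !inE !negb_or [beta == alpha]eq_sym alpha_neq_beta.
by rewrite -!andbA => /and4P[_ n1 _ n2]; rewrite ![beta == _]eq_sym n1 n2.
Qed.

Lemma keptE e : (e \in kept) = ~~ fconnect phi (i2 alpha) e && ~~ fconnect phi (i2 beta) e.
Proof.
have [_ fa] := five_alpha; have [_ fb] := five_beta.
have gen1 p d : face_length r1 p = 3 -> fconnect phi1 p d = (d \in [:: p; phi1 p; phi1 (phi1 p)]).
  by move=> lp; have [<- _] := order3P (@face_step_inj _ r1) lp.
have gen2 p d : face_length r2 p = 3 -> fconnect phi2 p d = (d \in [:: p; phi2 p; phi2 (phi2 p)]).
  by move=> lp; have [<- _] := order3P (@face_step_inj _ r2) lp.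
rewrite fa fb {fa fb}; have [[d /andP[dx dy] ->]|[d ->]] := dart_O_cases e.
  have -> : (i1 d \in kept) = (d \in kept1).
    rewrite inE (mem_imset _ _ i1_inj) orbC; case: imsetP => // -[d' _ E].
    by have := i1_neq_i2 d' dx dy; rewrite E eqxx.
  rewrite [LHS]inE !gen1 // !inE (negPf dx) (negPf dy) !(inj_eq i1_inj).
  by rewrite !(negPf (i1_neq_i2 _ dx dy)).
have -> : (i2 d \in kept) = (d \in kept2).
  rewrite inE (mem_imset _ _ i2_inj); case: imsetP => // -[d' /kept1_neq/andP[dx dy] E].
  by have := i1_neq_i2 d dx dy; rewrite E eqxx.
rewrite [LHS]inE !gen2 // !inE !(inj_eq i2_inj).
have /andP[x1 x2] := phi1_xy; have /andP[y1 y2] := phi1_yx.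
by rewrite !i2_eq_i1 // !orbF.
Qed.

(** The two maps of darts cover the composition and overlap exactly in the two shared darts. *)
Lemma card_dart_ore : #|dart O| + 2 = #|dart G1| + #|dart G2|.
Proof.
have : #|i1 @: [set: dart G1] :|: i2 @: [set: dart G2]| +
    #|i1 @: [set: dart G1] :&: i2 @: [set: dart G2]| = #|dart G1| + #|dart G2|.
  by rewrite cardsUI !card_imset ?cardsT //; [exact: i2_inj|exact: i1_inj].
have -> : i1 @: [set: dart G1] :|: i2 @: [set: dart G2] = [set: dart O].
  apply/setP => e; rewrite !inE; have [[d _ ->]|[d ->]] := dart_O_cases e.
    by rewrite imset_f ?inE.
  by rewrite [X in _ || X]imset_f ?inE ?orbT.
have -> : i1 @: [set: dart G1] :&: i2 @: [set: dart G2] = [set i2 alpha; i2 beta].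
  apply/setP => e; rewrite [RHS]inE !in_set1; apply/setIP/orP => [[/imsetP[d _ ->] /imsetP[d' _ E]]|].
    have [dE|dx] := eqVneq d dxy; first by rewrite dE i1_xy eqxx; left.
    have [dE|dy] := eqVneq d dyx; first by rewrite dE i1_yx eqxx; right.
    by have := i1_neq_i2 d' dx dy; rewrite E eqxx.
  by case=> /eqP ->; split; rewrite ?imset_f // -?i1_xy -?i1_yx imset_f.
by rewrite cardsT cards2 (inj_eq i2_inj) alpha_neq_beta.
Qed.

Lemma card_ore : #|O| + 1 = #|G1| + #|G2|.
Proof.
rewrite card_sum card_sig -addnA; congr (_ + _).
by rewrite (cardD1 z G2) inE addnC; congr (_ + _); apply: eq_card => w; rewrite !inE andbT.
Qed.

(** Each of the two merged faces replaces one face of G1 and one face of G2; all other faces are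
    kept. *)
Lemma R_faces : fcard phi {: dart O} + 2 = fcard phi1 {: dart G1} + fcard phi2 {: dart G2}.
Proof.
have fI := @face_step_inj _ R; have f1I := @face_step_inj _ r1; have f2I := @face_step_inj _ r2.
have sep : ~~ fconnect phi (i2 alpha) (i2 beta).
  have [_ ->] := five_alpha; have := separate2.
  have [-> _] := order3P f2I len_a.
  have /andP[x1 x2] := phi1_xy.
  by rewrite !inE !(inj_eq i2_inj) !i2_eq_i1 // !orbF.
rewrite (two_orbits fI sep keptE).
have k1E d : (d \in kept1) = ~~ fconnect phi1 dxy d && ~~ fconnect phi1 dyx d by rewrite inE.
have k2E d : (d \in kept2) = ~~ fconnect phi2 alpha d && ~~ fconnect phi2 beta d by rewrite inE.
rewrite (two_orbits f1I separate1 k1E) (two_orbits f2I separate2 k2E).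
rewrite fcardU; last first.
  rewrite -setI_eq0; apply/eqP/setP => e; rewrite !inE; apply/negP.
  case/andP=> /imsetP[d /kept1_neq/andP[dx dy] ->] /imsetP[d' _] /eqP.
  by rewrite (negPf (i1_neq_i2 _ dx dy)).
rewrite (fcard_hom i1_inj kept1_phi kept1_hom) // (fcard_hom i2_inj kept2_phi kept2_hom) //.
lia.
Qed.

Lemma R_spherical : spherical r1 -> spherical r2 -> spherical R.
Proof.
move=> [_ E1] [_ E2]; split; first exact: R_rotation.
have := R_faces; have := card_ore; have := card_dart_ore; move: E1 E2; lia.
Qed.

Lemma R_face_length (e : dart O) :
  [\/ exists2 d, e = i1 d & d \in kept1 /\ face_length R e = face_length r1 d,
      exists2 d, e = i2 d & d \in kept2 /\ face_length R e = face_length r2 d |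
      e \notin kept /\ face_length R e = 5].
Proof.
have [|ek] := boolP (e \in kept).
  case/setUP => /imsetP[d dk ->]; [apply: Or31|apply: Or32]; exists d => //; split=> //.
    exact: (order_hom i1_inj kept1_phi kept1_hom).
  exact: (order_hom i2_inj kept2_phi kept2_hom).
apply: Or33; split=> //; move: ek; rewrite keptE negb_and !negbK.
have fI := @face_step_inj _ R.
have same a : fconnect phi a e -> fingraph.order phi e = fingraph.order phi a.
  move=> ae; apply: eq_card => e'; rewrite -[LHS]/(fconnect _ _ _) -[RHS]/(fconnect _ _ _).
  by rewrite (same_connect (fconnect_sym fI) ae).
by case/orP => /same; rewrite /face_length => ->; [case: five_alpha|case: five_beta].
Qed.


Hypotheses (A0 : A != set0) (Az : A \proper neighbours z).
Hypotheses (cd1 : closed_diamonds G1) (cd2 : closed_diamonds G2).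

(** Since w has degree 3, the left vertex to which it is attached must be p or q. It is then
    adjacent to u as well, so w and u lie on the same side. *)
Lemma cn2_split_side (w u : {w : G2 | w != z}) p q :
  (val w \in A) != (val u \in A) -> adj z (val w) -> cn2 (rgt w) (rgt u) p q -> False.
Proof.
move=> wu zw c; have wx : adj (rgt w) (lft (att (val w))) by rewrite ore_adj_rl zw eqxx.
have := ore_closed_diamonds xy A0 Az cd1 cd2 c wx; rewrite !inE => lE.
have : adj (rgt u) (lft (att (val w))).
  case/and5P: c => _ _ _ up /andP[_ uq].
  by case/or3P: lE => /eqP // ->.
rewrite ore_adj_rl => /andP[_ /eqP E]; move: wu.
by rewrite -!attach_xy E eqxx.
Qed.

(** Only the dart opposite z avoids z on this triangular face. Its ends are consecutive around z
    across the boundary of a block, so they lie on different sides of the split. *)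
Lemma lost_right a d (tz : tail d != z) (hz : tip d != z) p q :
  tail a = z -> face_length r2 a = 3 -> a \in [:: alpha; beta] -> fconnect phi2 a d ->
  cn2 (rgt (exist _ (tail d) tz)) (rgt (exist _ (tip d) hz)) p q -> False.
Proof.
move=> az la aab; have [-> a3] := order3P (@face_step_inj _ r2) la.
have tphi e : tail (phi2 e) = tip e by rewrite rotation_tail.
rewrite !inE => /or3P[] /eqP dE c.
- by have := tz; rewrite dE az eqxx.
- move: c; apply: cn2_split_side => /=; last by rewrite dE tphi -az dart_adj.
  have := blocks (d := dart_rev (phi2 (phi2 a))); rewrite tail_rev -tphi a3 => /(_ az).
  rewrite [r2 _]a3 aab addbT tip_rev -dE tphi.
  by rewrite -tphi -dE => ->; case: (tip d \in A).
- by have := hz; rewrite dE -tphi a3 az eqxx.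
Qed.

Lemma lost_left p d : face_length r1 p = 3 -> p \in [:: dxy; dyx] -> d != p ->
  fconnect phi1 p d -> (tail d \in [:: x; y]) || (tip d \in [:: x; y]).
Proof.
move=> lp pxy dp; have [-> p3] := order3P (@face_step_inj _ r1) lp.
have tphi e : tail (phi1 e) = tip e by rewrite rotation_tail.
have txy : (tail p \in [:: x; y]) && (tip p \in [:: x; y]).
  by move: pxy; rewrite !inE => /orP[] /eqP -> /=; rewrite /tail /tip /= !eqxx ?orbT.
rewrite in_cons (negPf dp) !inE /= => /orP[] /eqP ->.
  by have /andP[_] := txy; rewrite tphi !inE => ->.
by have /andP[+ _] := txy; rewrite -{1}p3 tphi !inE => ->; rewrite orbT.
Qed.

Lemma R_good : good_drawing r1 -> good_drawing r2 -> good_drawing R.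
Proof.
case=> sp1 n1 f1 [sp2 n2 f2]; split; first exact: R_spherical.
  move=> e; case: (R_face_length e) => [[d _ [_ ->]]|[d _ [_ ->]]|[_ -> //]].
    exact: n1.
  exact: n2.
move=> e p q c.
have left d : d != dxy -> d != dyx -> e = i1 d -> exists p' q',
    [/\ cn2 (tail d) (tip d) p' q', (tail d != x) && (tail d != y) & (tip d != x) && (tip d != y)].
  move=> dx dy eE; move: c; rewrite eE (i1E dx dy).
  by case/(ore_cn2_left xy cd1) => p' [q' [_ _ c' ? ?]]; exists p', q'.
have right d : e = i2 d -> exists (tz : tail d != z) (hz : tip d != z),
    cn2 (rgt (exist _ (tail d) tz)) (rgt (exist _ (tip d) hz)) p q.
  move=> eE; move: c; rewrite eE /tail /tip /= -/(tail d) -/(tip d) => c0.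
  have td := adj_neq (dart_adj d).
  have tz : tail d != z.
    apply: contraTneq c0 => tz; have hz : tip d != z by rewrite -tz eq_sym.
    by rewrite tz place_z place_neq; apply/negP/(ore_cn2_mixed xy A0 Az cd2).
  have hz : tip d != z.
    apply: contraTneq c0 => hz.
    by rewrite hz place_z place_neq; apply/negP => /cn2C/(ore_cn2_mixed xy A0 Az cd2).
  by move: c0; rewrite !place_neq => c0; exists tz, hz.
case: (R_face_length e) => [[d eE [dk ->]]|[d eE [dk ->]]|[ek _]].
- have /andP[dx dy] := kept1_neq dk.
  by have [p' [q' [/f1 c' _ _]]] := left d dx dy eE.
- by have [tz [hz /ore_cn2_right/f2]] := right d eE.
(* No dart on a face of length 5 is the middle of a diamond: the left ones meet x or y, and the
   right ones either meet z or have their ends on different sides. *)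
case: (dart_O_cases e) => [[d /andP[dx dy] eE]|[d eE]]; exfalso.
  have [p' [q' [_ /andP[/negPf tx /negPf ty] /andP[/negPf hx /negPf hy]]]] := left d dx dy eE.
  have : d \notin kept1 by apply: contra ek => dk; rewrite inE eE imset_f.
  rewrite inE negb_and !negbK => /orP[] fc.
    have pp : dxy \in [:: dxy; dyx] by rewrite inE eqxx.
    by have := lost_left len_xy pp dx fc; rewrite !inE tx ty hx hy.
  have pp : dyx \in [:: dxy; dyx] by rewrite !inE eqxx orbT.
  by have := lost_left len_yx pp dy fc; rewrite !inE tx ty hx hy.
have [tz [hz c']] := right d eE.
have : d \notin kept2 by apply: contra ek => dk; rewrite inE eE [X in _ || X]imset_f ?orbT.
rewrite inE negb_and !negbK => /orP[] fc.
  by apply: (lost_right ta len_a _ fc c'); rewrite !inE eqxx.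
by apply: (lost_right tb len_b _ fc c'); rewrite !inE eqxx orbT.
Qed.

End Surgery.

Theorem ore_good_drawing (G1 G2 : sgraph) (x y : G1) (z : G2) (A : {set G2}) (xy : adj x y)
    (r1 : {perm dart G1}) (r2 : {perm dart G2}) (alpha beta : dart G2) a b :
  A != set0 -> A \proper neighbours z -> closed_diamonds G1 -> closed_diamonds G2 ->
  good_drawing r1 -> good_drawing r2 -> cn2 x y a b ->
  tail alpha = z -> tail beta = z -> tip alpha \in A -> tip beta \notin A ->
  (forall d, tail d = z ->
    (tip (r2 d) \in A) = (tip d \in A) (+) (r2 d \in [:: alpha; beta])) ->
  face_length r2 alpha = 3 -> face_length r2 beta = 3 ->
  exists R : {perm dart (ore_composition x y z A)}, good_drawing R.
Proof.
move=> A0 Az cd1 cd2 g1 g2 c ta tb aA bA blocks la lb.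
have [[rs1 _] _ f1] := g1; have [[rs2 _] _ _] := g2.
(* Both x and y have the further neighbour a, so the rotation at neither of them fixes the deleted
   dart. *)
have nofix (d : dart G1) u (du : adj (tail d) u) : u != tip d -> r1 d != d.
  move=> ud; apply: contra ud => /eqP rd.
  have /iter_findex E : fconnect r1 d (mk_dart du) by apply: rotation_connect.
  have := congr1 (@tip _) E; rewrite [X in tip X](_ : _ = d) => [->|] //.
  by elim: (findex _ _ _) => //= k ->.
case/and5P: (c) => _ _ xa ya _.
have r1x : r1 (dxy xy) != dxy xy.
  by apply: (nofix _ a) => //; rewrite eq_sym; exact: adj_neq.
have r1y : r1 (dyx xy) != dyx xy.
  by apply: (nofix _ a) => //; rewrite eq_sym; exact: adj_neq.
have lxy : face_length r1 (dxy xy) = 3 by exact: (f1 (dxy xy) a b c).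
have lyx : face_length r1 (dyx xy) = 3 by exact: (f1 (dyx xy) a b (cn2C c)).
have [R [R1 R2]] := rotation_exists z r2 rs1 r1x r1y aA bA.
exists R; exact: (R_good rs1 rs2 r1x r1y ta tb aA bA blocks R1 R2 lxy lyx la lb A0 Az cd1 cd2).
Qed.

(** * Criticality *)

(** Deleting an edge is expressed by a colouring that may fail on that edge only, so that no
    subgraph has to be built. As no vertex is isolated, every proper subgraph misses an edge. *)
Definition edge_critical (G : sgraph) :=
  [/\ ~ colorable G 3, forall v : G, exists w, adj v w &
      forall u v : G, adj u v -> exists f : G -> 'I_3,
        forall a b, adj a b -> f a = f b -> (a, b) = (u, v) \/ (a, b) = (v, u)].

Lemma edge_critical_four_critical G : edge_critical G -> four_critical G.
Proof.
case=> nc deg ec; split=> // H h [[hI hadj] prop].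
suff [u [v [uv miss]]] : exists u v : G, adj u v /\
    forall a b, adj a b -> (h a, h b) <> (u, v) /\ (h a, h b) <> (v, u).
  have [f fP] := ec u v uv; exists (f \o h) => a b ab; apply/eqP => /= E.
  by have [n1 n2] := miss a b ab; case: (fP _ _ (hadj _ _ ab) E).
case: prop => [[w wP]|[u [v [uv nuv]]]].
  have [w' ww'] := deg w; exists w, w'; split=> // a b _.
  by split=> -[Ea Eb]; [have := wP a; rewrite Ea eqxx|have := wP b; rewrite Eb eqxx].
exists (h u), (h v); split=> // a b ab.
by split=> -[/hI Ea /hI Eb]; move: nuv; rewrite -Ea -Eb ?ab // adj_sym ab.
Qed.

Lemma edge_critical_iso G H : isomorphic G H -> edge_critical H -> edge_critical G.
Proof.
case=> h bh hadj [nc deg ec]; have hI := bij_inj bh; have [g hK gK] := bh; split.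
- case=> f fP; apply: nc; exists (f \o g) => u v uv; apply: fP.
  by rewrite -hadj !gK.
- by move=> v; have [w vw] := deg (h v); exists (g w); rewrite -hadj gK.
move=> u v; rewrite -hadj => /ec[f fP]; exists (f \o h) => a b; rewrite -hadj => ab /= E.
by case: (fP _ _ ab E) => -[/hI -> /hI ->]; [left|right].
Qed.

Lemma edge_critical_K4 G : isK4 G -> edge_critical G.
Proof.
move=> K; split.
- case=> f fP; have /leq_card : injective f.
    move=> u v E; apply/eqP; apply: contraT => uv.
    by have := fP u v; rewrite K.2 uv E eqxx => /(_ isT).
  by rewrite K.1 card_ord.
- move=> v; have [a [b [c [U _]]]] := others_K4 K v; exists a; rewrite K.2.
  by move: U; rewrite /= !inE !negb_or => /andP[/andP[]].
move=> u v; rewrite K.2 => uv.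
have /eqP/cards2P[p [q [pq E]]] : #|common u v| = 2 by exact: card_common_K4.
have C w : [|| w == u, w == v, w == p | w == q].
  have : (w \in common u v) = (w \in [set p; q]) by rewrite E.
  by rewrite !inE !K.2 ![w == _]eq_sym; case: (u == w); case: (v == w) => //= <-.
exists (fun w => if w == p then inord 1 else if w == q then inord 2 else inord 0).
have d01 : inord 0 != inord 1 :> 'I_3 by rewrite -(inj_eq val_inj) /= !inordK.
have d02 : inord 0 != inord 2 :> 'I_3 by rewrite -(inj_eq val_inj) /= !inordK.
have d12 : inord 1 != inord 2 :> 'I_3 by rewrite -(inj_eq val_inj) /= !inordK.
move=> a b; rewrite K.2 => ab; have := C a; have := C b.
have [aE|ap] := eqVneq a p; have [bE|bp] := eqVneq b p.
- by move: ab; rewrite aE bE eqxx.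
- have [bE|bq] := eqVneq b q; first by move=> _ _ /eqP; rewrite (negPf d12).
  by move=> _ _ /esym/eqP; rewrite (negPf d01).
- have [aE|aq] := eqVneq a q; first by move=> _ _ /esym/eqP; rewrite (negPf d12).
  by move=> _ _ /eqP; rewrite (negPf d01).
have [aE|aq] := eqVneq a q; have [bE|bq] := eqVneq b q.
- by move: ab; rewrite aE bE eqxx.
- by move=> _ _ /esym/eqP; rewrite (negPf d02).
- by move=> _ _ /eqP; rewrite (negPf d02).
rewrite !orbF => /orP[] /eqP bE /orP[] /eqP aE _; subst a b; rewrite ?eqxx // in ab.
- by right.
- by left.
Qed.

Lemma perm_move2 (T : finType) (k1 k2 c1 c2 : T) : k1 != k2 -> c1 != c2 ->
  exists s : {perm T}, s k1 = c1 /\ s k2 = c2.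
Proof.
move=> k12 c12; pose k2' := tperm k1 c1 k2.
have k2c1 : c1 != k2' by rewrite -(inj_eq (@perm_inj _ (tperm k1 c1))) tpermR tpermK.
exists (tperm k1 c1 * tperm k2' c2)%g; rewrite !permM tpermL tpermL; split=> //.
by rewrite tpermD // eq_sym.
Qed.

Lemma third_color (c1 c2 : 'I_3) : exists k, (k != c1) && (k != c2).
Proof.
have /card_gt0P[k] : 0 < #|~: [set c1; c2]|.
  by rewrite cardsCs setCK card_ord subn_gt0 cards2; case: eqP.
by rewrite !inE negb_or => kP; exists k.
Qed.

Section OreCritical.

Variables (G1 G2 : sgraph) (x y : G1) (z : G2) (A : {set G2}).
Hypotheses (xy : adj x y) (A0 : A != set0) (Az : A \proper neighbours z).
Hypotheses (ec1 : edge_critical G1) (ec2 : edge_critical G2).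
Variables a1 a2 : G2.
Hypotheses (a1A : a1 \in A) (A2 : forall w, w \in A -> w = a1 \/ w = a2).

Local Notation O := (ore_composition x y z A).
Local Notation lft a := (inl a : O).
Local Notation rgt w := (inr w : O).

Definition merge_coloring (f1 : G1 -> 'I_3) (f2 : G2 -> 'I_3) (u : O) :=
  match u with inl a => f1 a | inr w => f2 (val w) end.

Lemma edge_coloring (G : sgraph) (u v : G) : edge_critical G -> adj u v ->
  exists2 f : G -> 'I_3, f u = f v &
    forall a b, adj a b -> f a = f b -> (a, b) = (u, v) \/ (a, b) = (v, u).
Proof.
case=> nc _ ec uv; have [f fP] := ec u v uv; exists f => //.
have [//|fuv] := eqVneq (f u) (f v); case: nc; exists f => a b ab.
apply: contra fuv => /eqP E; move: (E).
by case: (fP _ _ ab E) => -[-> ->] ->.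
Qed.

(** If x and y have the same colour, giving it to z colours G2; otherwise the colouring also
    respects xy and colours G1. *)
Lemma ore_not_colorable : ~ colorable O 3.
Proof.
case=> F FP; have [nc1 _ _] := ec1; have [nc2 _ _] := ec2.
have [Fxy|Fxy] := eqVneq (F (lft x)) (F (lft y)).
  apply: nc2; exists (fun v => if insub v is Some w then F (rgt w) else F (lft x)) => u v uv.
  have zcase w (wz : w != z) : adj z w -> F (lft x) != F (rgt (exist _ w wz)).
    move=> zw; have : adj (lft (attach x y A w)) (rgt (exist _ w wz)) by rewrite ore_adj_lr /= eqxx zw.
    by move/FP; rewrite /attach; case: ifP => _; rewrite -?Fxy.
  have [uz|uz] := eqVneq u z; have [vz|vz] := eqVneq v z.
  - by have := adj_neq uv; rewrite uz vz eqxx.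
  - by rewrite uz insubF ?eqxx // insubT zcase // -uz.
  - by rewrite vz insubT insubF ?eqxx // eq_sym zcase // -vz adj_sym.
  - by rewrite !insubT; apply: FP.
apply: nc1; exists (fun a => F (lft a)) => a b ab.
have [[-> ->] //|n1] := eqVneq (a, b) (x, y).
have [[-> ->]|n2] := eqVneq (a, b) (y, x); first by rewrite eq_sym.
by apply: FP; rewrite ore_adj_ll ab n1.
Qed.

(** A colouring of G1 - uv gives x and y different colours. In a colouring g of G2 without the edge
    from z to [a1], only this neighbour of z shares its colour, so y may take the colour of z. A
    colour k other than those of [a1] and [a2] suits x: it differs from that of z, which is the
    colour of [a1]. A permutation of colours matches the two sides. *)
Lemma ore_left_edge u v : adj (lft u) (lft v) -> exists f : O -> 'I_3,
  forall a b, adj a b -> f a = f b -> (a, b) = (lft u, lft v) \/ (a, b) = (lft v, lft u).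
Proof.
rewrite ore_adj_ll => /and3P[uv n1 n2].
have [f1 _ f1P] := edge_coloring ec1 uv.
have fxy : f1 x != f1 y.
  apply/eqP => /(f1P _ _ xy)[] [Ex Ey]; first by rewrite Ex Ey eqxx in n1.
  by rewrite Ex Ey eqxx in n2.
have za1 : adj z a1 by have := subsetP (proper_sub Az) a1 a1A; rewrite inE.
have [g gz gP] := edge_coloring ec2 za1.
have [k /andP[k1 k2]] := third_color (g a1) (g a2).
have [|s [sk sz]] := perm_move2 (k1 := k) (k2 := g z) _ fxy; first by rewrite gz.
exists (merge_coloring f1 (s \o g)).
have link a w : adj (lft a) (rgt w) -> f1 a <> s (g (val w)).
  rewrite ore_adj_lr => /andP[zw /eqP ->]; rewrite /attach; case: ifP => wA.
    rewrite -sk => /perm_inj kE.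
    by case: (A2 wA) => E; [move: k1|move: k2]; rewrite kE E eqxx.
  rewrite -sz => /perm_inj/(gP _ _ zw)[] [E]; first by move: wA; rewrite [val w]E a1A.
  by move=> _; have /eqP := adj_neq za1.
move=> [a|w] [b|w'] /=.
- move=> /andP[ab _] /(f1P _ _ ab)[] [-> ->]; [by left|by right].
- by move=> aw /(link _ _ aw).
- by move=> aw /esym/link[]; rewrite adj_sym.
- move=> ww' /perm_inj/(gP _ _ ww')[] [E E'].
    by have := valP w; rewrite /= E eqxx.
  by have := valP w'; rewrite /= E' eqxx.
Qed.

(** A colouring of G1 - xy gives x and y the same colour, so both can play the part of z in a
    colouring of G2 without the projected edge. *)
Lemma ore_right_edge u w : adj u (rgt w) -> exists f : O -> 'I_3,
  forall a b, adj a b -> f a = f b -> (a, b) = (u, rgt w) \/ (a, b) = (rgt w, u).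
Proof.
move=> uw; have pw : adj (ore_proj u) (val w).
  by rewrite adj_sym; apply: inr_adj_proj; rewrite adj_sym.
have [f2 _ f2P] := edge_coloring ec2 pw.
have [f1 fxy f1P] := edge_coloring ec1 xy.
pose s := tperm (f1 x) (f2 z).
exists (merge_coloring (fun a => s (f1 a)) f2).
have back a w' : adj a (rgt w') -> f2 (ore_proj a) = f2 (val w') ->
    (a, rgt w') = (u, rgt w) \/ (a, rgt w') = (rgt w, u).
  move=> aw; have pw' : adj (ore_proj a) (val w').
    by rewrite adj_sym; apply: inr_adj_proj; rewrite adj_sym.
  case/(f2P _ _ pw') => -[Ea Ew].
    move/val_inj: Ew => Ew; left; subst w'; congr (_, _).
    by apply: (@ore_proj_inj _ _ _ _ _ _ w); rewrite // adj_sym.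
  have aE : a = rgt w.
    case: a Ea {aw pw'} => [a|a] /= Ea; first by have := valP w; rewrite /= -Ea eqxx.
    by rewrite (val_inj Ea).
  right; rewrite aE; congr (_, _); subst a.
  by apply: (@ore_proj_inj _ _ _ _ _ _ w); rewrite // adj_sym.
have fatt w' : f1 (attach x y A w') = f1 x by rewrite /attach; case: ifP.
move=> [a|v] [b|w'].
- rewrite ore_adj_ll => /and3P[ab n1 n2] /= /perm_inj/(f1P _ _ ab)[] E.
    by rewrite E eqxx in n1.
  by rewrite E eqxx in n2.
- move=> aw /= E; apply: back => //=; rewrite -E.
  by move: aw; rewrite ore_adj_lr => /andP[_ /eqP ->]; rewrite fatt /s tpermL.
- move=> aw /= E; have [||[-> ->]|[-> ->]] := back (lft b) v; [by rewrite adj_sym| |by right|by left].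
  rewrite /= E.
  by move: aw; rewrite ore_adj_rl => /andP[_ /eqP ->]; rewrite fatt /s tpermL.
- exact: back.
Qed.

Lemma ore_edge_critical : edge_critical O.
Proof.
have [_ deg1 _] := ec1; have [_ deg2 _] := ec2.
split; first exact: ore_not_colorable.
  have x' : exists w, adj (lft x) w.
    have za1 : adj z a1 by have := subsetP (proper_sub Az) a1 a1A; rewrite inE.
    have a1z : a1 != z by rewrite eq_sym adj_neq.
    by exists (rgt (exist _ a1 a1z)); rewrite ore_adj_lr /= za1 /attach a1A eqxx.
  have y' : exists w, adj (lft y) w.
    have [_ [e eN eA]] := properP Az; rewrite inE in eN.
    have ez : e != z by rewrite eq_sym adj_neq.
    by exists (rgt (exist _ e ez)); rewrite ore_adj_lr /= eN /attach (negPf eA) eqxx.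
  move=> [a|w].
    have [->//|ax] := eqVneq a x; have [->//|ay] := eqVneq a y.
    have [b ab] := deg1 a; exists (lft b); rewrite ore_adj_ll ab !xpair_eqE (negPf ax) (negPf ay).
    by [].
  have [v wv] := deg2 (val w); have [vz|vz] := eqVneq v z.
    have zw : adj z (val w) by rewrite -[z in adj z]vz adj_sym.
    by exists (lft (attach x y A (val w))); rewrite ore_adj_rl eqxx zw.
  by exists (rgt (exist _ v vz)).
move=> u [v|w] uv; last exact: ore_right_edge.
case: u uv => [u|w] uv; first exact: ore_left_edge.
have [|f fP] := @ore_right_edge (lft v) w; first by rewrite adj_sym.
by exists f => a b ab /(fP _ _ ab)[]; [right|left].
Qed.

End OreCritical.

(** * The Moser spindle *)

Section ListCheck.

Variables (n : nat) (rot : nat -> seq nat) (ok : list_graph_ok n rot).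

Lemma list_cn2 (u v p q : list_graph ok) : cn2 u v p q ->
  (val v \in rot (val u)) && (1 < count [in rot (val v)] (rot (val u))).
Proof.
case/and5P=> uv pq up vp /andP[uq vq]; rewrite [val v \in _]uv /= -size_filter.
have U : uniq [:: val p; val q] by rewrite /= inE pq.
apply: (uniq_leq_size U) => w; rewrite !inE mem_filter => /orP[] /eqP ->.
  by apply/andP; split; [exact: vp|exact: up].
by apply/andP; split; [exact: vq|exact: uq].
Qed.

Lemma list_check (P : nat -> nat -> bool) :
  all (fun u => all (fun v => (count [in rot v] (rot u) < 2) || P u v) (rot u)) (iota 0 n) ->
  forall u v p q : list_graph ok, cn2 u v p q -> P (val u) (val v).
Proof.
move=> /allP chk u v p q /list_cn2/andP[uv c2].
have := chk (val u); rewrite mem_iota /= => /(_ (ltn_ord u))/allP/(_ _ uv).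
by rewrite ltnNge c2.
Qed.

Lemma list_good_drawing : transitive_ok n rot -> euler_ok n rot ->
  all (fun u => all (fun v => (count [in rot v] (rot u) < 2) || face_len rot 3 (u, v)) (rot u)) (iota 0 n) ->
  good_drawing (list_rotation ok).
Proof.
move=> tr eu f3; have fl := @list_face_length _ _ ok eu; split; first exact: list_spherical.
  by move=> d; rewrite fl; case: ifP.
by move=> d p q /(list_check f3) l3; rewrite fl l3.
Qed.

End ListCheck.

Definition K4_rot := nth [::] [:: [:: 1; 2; 3]; [:: 0; 3; 2]; [:: 0; 1; 3]; [:: 0; 2; 1]].

Lemma K4_rot_ok : list_graph_ok 4 K4_rot. Proof. by []. Qed.

Lemma K4_good_drawing G : isK4 G -> exists r : {perm dart G}, good_drawing r.
Proof.
move=> K; have c4 : #|G| = 4 by exact: K.1.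
pose h (v : G) : list_graph K4_rot_ok := cast_ord c4 (enum_rank v).
have bh : bijective h.
  exists (fun i => enum_val (cast_ord (esym c4) i)) => v; rewrite /h.
    by rewrite cast_ordK enum_rankK.
  by rewrite enum_valK cast_ordKV.
apply: (@good_drawing_iso _ _ h bh _ (list_rotation K4_rot_ok)).
  move=> u v; rewrite K.2 -(inj_eq (bij_inj bh)).
  by case: (h u) (h v) => [[|[|[|[|//]]]] i] [[|[|[|[|//]]]] j].
by apply: list_good_drawing; vm_compute.
Qed.

(* The Moser spindle: the diamonds 0-1-2-5 and 0-3-4-6 with middle edges 12 and
   34, and the edge 56. *)
Definition moser_rot := nth [::]
  [:: [:: 2; 1; 3; 4]; [:: 0; 2; 5]; [:: 1; 0; 5]; [:: 4; 0; 6]; [:: 0; 3; 6]; [:: 1; 2; 6]; [:: 4; 3; 5]].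

Lemma moser_ok : list_graph_ok 7 moser_rot. Proof. by []. Qed.

Definition moser : sgraph := list_graph moser_ok.

(** G is a Moser spindle with centre v, and ab and de are the middle edges of its two diamonds. *)
Definition moser_at (G : sgraph) (v a b d e : G) :=
  exists h : G -> moser, [/\ bijective h, forall u v, adj (h u) (h v) = adj u v &
    [:: val (h v); val (h a); val (h b); val (h d); val (h e)] = [:: 0; 1; 2; 3; 4]].

Lemma moser_at_iso (G H : sgraph) (f : G -> H) v a b d e : bijective f ->
  (forall u v, adj (f u) (f v) = adj u v) ->
  moser_at (f v) (f a) (f b) (f d) (f e) -> moser_at v a b d e.
Proof.
move=> bf fadj [h [bh hadj hE]]; exists (h \o f); split=> //; first exact: bij_comp.
by move=> u w; rewrite -fadj -hadj.
Qed.

Lemma moser_atI (G : sgraph) (v a b d e s t : G) :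
  uniq [:: v; a; b; d; e; s; t] -> #|G| = 7 ->
  (forall i j, i < j < 7 ->
    adj (nth v [:: v; a; b; d; e; s; t] i) (nth v [:: v; a; b; d; e; s; t] j) = (j \in moser_rot i)) ->
  moser_at v a b d e.
Proof.
set L := [:: v; a; b; d; e; s; t] => U c7 adjL.
pose k (i : moser) : G := nth v L (val i).
have kI : injective k.
  move=> i j /eqP; rewrite nth_uniq //; last exact: ltn_ord; last exact: ltn_ord.
  by move/eqP/val_inj.
have kadj i j : adj (k i) (k j) = adj i j.
  case: (ltngtP (val i) (val j)) => ij.
  - by rewrite /k adjL // ij; exact: ltn_ord.
  - by rewrite adj_sym [RHS]adj_sym /k adjL // ij; exact: ltn_ord.
  - by move/val_inj: ij => ->; rewrite !adj_irr.
have [h hK kK] := inj_card_bij kI (eq_leq (etrans c7 (esym (card_ord 7)))).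
exists h; split; first by exists k.
  by move=> u w; rewrite -kadj !kK.
have hE i (i7 : i < 7) : h (nth v L i) = Ordinal i7 by rewrite -[RHS]hK.
by rewrite (hE 0 isT) (hE 1 isT) (hE 2 isT) (hE 3 isT) (hE 4 isT).
Qed.

(** The automorphism of the spindle that exchanges its two diamonds. *)
Definition moser_swap_val := nth 0 [:: 0; 3; 4; 1; 2; 6; 5].

Lemma moser_swap_subproof (i : 'I_7) : moser_swap_val i < 7.
Proof. by case: i => [[|[|[|[|[|[|[|//]]]]]]] i]. Qed.

Definition moser_swap (i : moser) : moser := Ordinal (moser_swap_subproof i).

Lemma moser_swapK : involutive moser_swap.
Proof.
by move=> i; apply: val_inj; case: i => [[|[|[|[|[|[|[|//]]]]]]] i].
Qed.

Lemma moser_at_swap (G : sgraph) (v a b d e : G) : moser_at v a b d e -> moser_at v d e a b.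
Proof.
case=> h [bh hadj [hv ha hb hd he]]; exists (moser_swap \o h); split.
- by apply: bij_comp bh; exact: inv_bij moser_swapK.
- move=> u w; rewrite -hadj -[LHS]/(adj (moser_swap (h u)) (moser_swap (h w))).
  case: (h u) (h w) => [[|[|[|[|[|[|[|//]]]]]]] i] [[|[|[|[|[|[|[|//]]]]]]] j];
  by [].
- by rewrite /= hv ha hb hd he.
Qed.

Lemma moser_at_mid (G : sgraph) (v a b d e u w p q : G) : moser_at v a b d e ->
  cn2 u w p q -> (u, w) \in [:: (a, b); (b, a); (d, e); (e, d)].
Proof.
case=> h [bh hadj [hv ha hb hd he]] c.
have c' : cn2 (h u) (h w) (h p) (h q).
  by move: c; rewrite /cn2 !hadj (inj_eq (bij_inj bh)).
have chk : all (fun u => all (fun v => (count [in moser_rot v] (moser_rot u) < 2) ||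
    ((u, v) \in [:: (1, 2); (2, 1); (3, 4); (4, 3)])) (moser_rot u)) (iota 0 7).
  by vm_compute.
have := list_check (P := fun u v => (u, v) \in [:: (1, 2); (2, 1); (3, 4); (4, 3)]) chk c'.
have hI := inj_comp val_inj (bij_inj bh).
have E s t : (s == t) = (h s == h t :> nat) by rewrite -(inj_eq hI).
by rewrite !inE !xpair_eqE !E ha hb hd he.
Qed.

(** The centre is the only vertex of degree 4; all others have degree 3. *)
Lemma moser_at_center (G : sgraph) (v a b d e u : G) (s : seq G) : moser_at v a b d e ->
  uniq s -> size s = 4 -> {in s, forall w, adj u w} -> u = v.
Proof.
case=> h [bh hadj [hv _ _ _ _]] us s4 us_adj.
have hI := inj_comp val_inj (bij_inj bh); apply: (hI); rewrite /= hv.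
have : size s <= size (moser_rot (val (h u))).
  rewrite -(size_map (val \o h)); apply: uniq_leq_size.
    by rewrite map_inj_uniq.
  by move=> _ /mapP[w /us_adj uw ->]; move: uw; rewrite -hadj.
by rewrite {}s4; case: (h u) => [[|[|[|[|[|[|[|//]]]]]]] i].
Qed.

Lemma moser_at_nbr (G : sgraph) (v a b d e w : G) : moser_at v a b d e ->
  adj v w = (w \in [:: a; b; d; e]).
Proof.
case=> h [bh hadj [hv ha hb hd he]].
have hI := inj_comp val_inj (bij_inj bh).
rewrite -hadj -[adj _ _]/(nat_of_ord (h w) \in moser_rot (h v)) hv !inE.
have E s t : (s == t) = (h s == h t :> nat) by rewrite -(inj_eq hI).
rewrite !E ha hb hd he.
by rewrite orbCA.
Qed.

Lemma moser_at_nonadj (G : sgraph) (v a b d e : G) : moser_at v a b d e -> adj a d = false.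
Proof.
case=> h [bh hadj [hv ha hb hd he]].
by rewrite -hadj -[adj _ _]/(nat_of_ord (h d) \in moser_rot (h a)) ha hd.
Qed.

(** In this cyclic order a, d and e, b are intervals, so a split of the centre into these two pairs
    has blocks that start at a and e, each with a triangular face at its first dart. *)
Lemma moser_rotation (G : sgraph) (v a b d e : G) (va : adj v a) (ve : adj v e) : moser_at v a b d e ->
  exists r : {perm dart G}, [/\ good_drawing r,
    face_length r (mk_dart va) = 3, face_length r (mk_dart ve) = 3 &
    forall f, tail f = v -> tip (r f) = next [:: b; a; d; e] (tip f)].
Proof.
case=> h [bh hadj [hv ha hb hd he]].
pose r0 := list_rotation moser_ok.
have eu : euler_ok 7 moser_rot by vm_compute.
have tr : transitive_ok 7 moser_rot by vm_compute.
have g0 : good_drawing r0 by apply: list_good_drawing; vm_compute.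
have [r' [rE fE rg]] := drawing_iso bh hadj r0.
exists r'; split; first exact: rg.
- by rewrite fE (list_face_length eu) /pair_of /tail /tip /= hv ha.
- by rewrite fE (list_face_length eu) /pair_of /tail /tip /= hv he.
have hI : injective (fun w => nat_of_ord (h w)) by exact: inj_comp val_inj (bij_inj bh).
move=> f fv; apply: (hI); transitivity (next [:: 2; 1; 3; 4] (h (tip f))).
  have -> : nat_of_ord (h (tip (r' f))) = tip (dart_iso hadj (r' f)) by [].
  rewrite rE permE; have -> : [:: 2; 1; 3; 4] = moser_rot (h (tail f)) by rewrite fv hv.
  by [].
have u4 : uniq [:: b; a; d; e] by rewrite -(map_inj_uniq hI) /= ha hb hd he.
by have := next_map hI u4 (tip f); rewrite [map _ _]/= ha hb hd he => ->.
Qed.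

(** * Structure of 4-Ore graphs with four triangles *)

Definition triangle_at (G : sgraph) (v p q : G) := [&& adj v p, adj v q & adj p q].

(** Vacuous for K4, which has too few vertices. It makes the bow tie case of a split explicit enough
    to be drawn. *)
Definition moser_bowties (G : sgraph) := forall v p q p' q' : G,
  triangle_at v p q -> triangle_at v p' q' -> uniq [:: p; q; p'; q'] -> moser_at v p q p' q'.

Record structured (G : sgraph) : Prop := Structured {
  st_conn : connected G;
  st_diamonds : closed_diamonds G;
  st_bowties : moser_bowties G;
  st_critical : edge_critical G;
  st_drawing : exists r : {perm dart G}, good_drawing r }.

Lemma connected_iso G H : isomorphic G H -> connected H -> connected G.
Proof.
case=> h bh hadj cH u v; have [g hK gK] := bh.
have gadj a b : adj a b -> adj (g a) (g b) by rewrite -hadj !gK.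
have /connectP[p pP E] := cH (h u) (h v).
apply/connectP; exists (map g p); last by rewrite -(hK v) E -{2}(hK u) last_map.
rewrite -{1}(hK u); elim: p (h u) pP {E} => //= b p IH a /andP[ab /IH ->].
by rewrite gadj.
Qed.

Lemma structured_iso G H : isomorphic G H -> structured H -> structured G.
Proof.
move=> GH; have [h bh hadj] := GH; case=> c d b e [r gr]; split.
- exact: connected_iso c.
- exact: closed_diamonds_iso d.
- move=> v p q p' q' t t' U; apply: (moser_at_iso bh hadj); apply: b.
  + by rewrite /triangle_at !hadj.
  + by rewrite /triangle_at !hadj.
  + by rewrite -(map_inj_uniq (bij_inj bh)) in U.
- exact: edge_critical_iso e.
- exact: good_drawing_iso bh hadj r gr.
Qed.

Lemma structured_K4 G : isK4 G -> structured G.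
Proof.
move=> K; split.
- move=> u v; have [->|uv] := eqVneq u v; first exact: connect0.
  by apply: connect1; rewrite K.2.
- exact: closed_diamonds_K4.
- move=> v p q p' q' /and3P[vp vq _] /and3P[vp' vq' _] U.
  have U5 : uniq [:: v; p; q; p'; q'].
    by move: vp vq vp' vq'; rewrite cons_uniq U !K.2 andbT !inE !negb_or => -> -> -> ->.
  by have := max_card (mem [:: v; p; q; p'; q']); rewrite (card_uniqP U5) K.1.
- exact: edge_critical_K4.
- exact: K4_good_drawing.
Qed.

(** Allows the single vertex that is split off in the diamond case to be assumed in A. *)
Lemma ore_swap (G1 G2 : sgraph) (x y : G1) (z : G2) (A : {set G2}) :
  isomorphic (ore_composition x y z A) (ore_composition y x z (neighbours z :\: A)).
Proof.
exists id; first by exists id.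
have link a w : ore_link y x z (neighbours z :\: A) a w = ore_link x y z A a w.
  by rewrite /ore_link !inE; case: (adj z w) => //=; rewrite andbT negbK orbC.
move=> [a|w] [b|w'] //=; rewrite ?link //.
by rewrite orbC.
Qed.

Lemma order_step (T : finType) (f : T -> T) e : injective f ->
  fingraph.order f (f e) = fingraph.order f e.
Proof.
move=> fI; apply: eq_card => e'.
by rewrite -[LHS]/(fconnect f _ _) -[RHS]/(fconnect f _ _) -same_fconnect1.
Qed.

(** With pq an edge, each of the four vertices is an end of the middle edge of a diamond on them, so
    no edge leaves the set. *)
Lemma K4_component (G : sgraph) (u v p q : G) : connected G -> closed_diamonds G ->
  cn2 u v p q -> adj p q -> #|G| = 4 /\ forall w, w \in [:: u; v; p; q].
Proof.
move=> con cd c pq; have /and5P[uv pq' up vp /andP[uq vq]] := c.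
have c' : cn2 p q u v by rewrite /cn2 pq (adj_neq uv) ![adj p _]adj_sym ![adj q _]adj_sym up vp uq vq.
have cl s t : s \in [:: u; v; p; q] -> adj s t -> t \in [:: u; v; p; q].
  rewrite !inE => /or4P[] /eqP -> st.
  - by have := cd _ _ _ _ _ c st; rewrite !inE => /or3P[] ->; rewrite ?orbT.
  - by have := cd _ _ _ _ _ (cn2C c) st; rewrite !inE => /or3P[] ->; rewrite ?orbT.
  - by have := cd _ _ _ _ _ c' st; rewrite !inE => /or3P[] ->; rewrite ?orbT.
  - by have := cd _ _ _ _ _ (cn2C c') st; rewrite !inE => /or3P[] ->; rewrite ?orbT.
have all4 w : w \in [:: u; v; p; q].
  have /connectP[s sP ->] := con u w.
  have inL r : r \in [:: u; v; p; q] -> path (@adj G) r s -> last r s \in [:: u; v; p; q].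
    elim: {sP w} s r => [|t s IH] r //= rL /andP[rt]; apply: IH; exact: cl rt.
  by apply: inL sP; rewrite mem_head.
split=> //; have U : uniq [:: u; v; p; q].
  by rewrite /= !inE !negb_or !adj_neq.
by rewrite -[4]/(size [:: u; v; p; q]) -(card_uniqP U); apply: eq_card => w; rewrite all4.
Qed.

(** * The induction step for the structural properties *)

Section Step.

Variables (G1 G2 : sgraph) (x y : G1) (z : G2) (A : {set G2}).
Hypotheses (xy : adj x y) (A0 : A != set0) (Az : A \proper neighbours z).
Hypotheses (s1 : structured G1) (s2 : structured G2).
Variables (a b : G1).
Hypothesis xyab : cn2 x y a b.

Local Notation O := (ore_composition x y z A).
Local Notation lft a := (inl a : O).
Local Notation rgt w := (inr w : O).
Local Notation att := (attach x y A).

(* Either zw is the middle edge of a diamond and w is split off from its ends c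
   and d, or A picks one vertex from each triangle of a bow tie centred at z. *)
Definition splitting :=
  (exists w c d, cn2 z w c d /\ A = [set w]) \/
  (exists p q p' q', [/\ triangle_at z p q, triangle_at z p' q',
     uniq [:: p; q; p'; q'] & A = [set p; p']]).

Hypothesis split : splitting.

Let cd1 := st_diamonds s1.
Let cd2 := st_diamonds s2.
Let bt2 := st_bowties s2.

Lemma ore_connected : connected O.
Proof.
have ac : connect_sym (@adj O) := sym_connect_sym (@adj_sym O).
have step1 u v : adj u v -> connect (@adj O) (lft u) (lft v).
  move=> uv; have xy' : connect (@adj O) (lft x) (lft y).
    case/and5P: xyab => _ _ xa ya _; apply: (@connect_trans _ _ (lft a)); apply: connect1.
      by rewrite ore_adj_ll xa !xpair_eqE [a == y]eq_sym !negb_and (adj_neq ya) orbT (adj_neq xy).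
    rewrite adj_sym ore_adj_ll ya !xpair_eqE [a == x]eq_sym (negPf (adj_neq xa)) !andbF.
    by rewrite [y == x]eq_sym (negPf (adj_neq xy)).
  have [[-> ->] //|n1] := eqVneq (u, v) (x, y).
  have [[-> ->] //|n2] := eqVneq (u, v) (y, x); first by rewrite ac.
  by apply: connect1; rewrite ore_adj_ll uv n1.
have left u v : connect (@adj O) (lft u) (lft v).
  have /connectP[p pP ->] := st_conn s1 u v.
  elim: p u pP => [|w p IH] u /=; first by move=> _; exact: connect0.
  by move=> /andP[/step1 uw /IH]; exact: connect_trans.
have right (v : G2) (vz : v != z) : connect (@adj O) (rgt (exist _ v vz)) (lft x).
  have /connectP[p pP] := st_conn s2 v z.
  elim: p v vz pP => [|w p IH] v vz /=; first by move=> _ E; case/eqP: (vz).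
  move=> /andP[vw pP] E; have [wz|wz] := eqVneq w z.
    have zv : adj z v by rewrite -wz adj_sym.
    apply: (@connect_trans _ _ (lft (att v))); last exact: left.
    have e : adj (rgt (exist _ v vz)) (lft (att v)) by rewrite ore_adj_rl /= eqxx zv.
    exact: connect1 e.
  apply: connect_trans (IH w wz pP E); exact: connect1.
have toX (u : O) : connect (@adj O) u (lft x).
  by case: u => [u|[u uz]]; [exact: left|exact: right].
by move=> u v; apply: connect_trans (toX u) _; rewrite ac.
Qed.

Lemma ore_critical : edge_critical O.
Proof.
case: split => [[w [c [d [_ AE]]]]|[p [q [p' [q' [_ _ _ AE]]]]]].
  apply: (ore_edge_critical xy Az (st_critical s1) (st_critical s2) (a1 := w) (a2 := w)).
    by rewrite AE inE.
  by move=> v; rewrite AE inE => /eqP; left.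
apply: (ore_edge_critical xy Az (st_critical s1) (st_critical s2) (a1 := p) (a2 := p')).
  by rewrite AE !inE eqxx.
by move=> v; rewrite AE !inE => /orP[] /eqP; [left|right].
Qed.

Lemma ore_drawing : exists R : {perm dart O}, good_drawing R.
Proof.
have [r1 g1] := st_drawing s1.
case: split => [[w [c [d [zwcd AE]]]]|[p [q [p' [q' [t t' U AE]]]]]].
  have [r2 g2] := st_drawing s2; have [[rs2 _] _ f2] := g2.
  have zw : adj z w by case/and5P: zwcd.
  (* The block of A consists of the single dart zw, so the other block starts at its successor. *)
  pose al := mk_dart zw; pose be := r2 al.
  have wA v : (v \in A) = (v == w) by rewrite AE inE.
  have tbe : tail be = z by rewrite rotation_tail.
  have bal : be != al.
    case/and5P: zwcd => _ _ zc wc _; apply: contraTneq wc => E.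
    have /iter_findex Ei : fconnect r2 al (mk_dart zc) by apply: rotation_connect.
    have fix_al k : iter k r2 al = al by elim: k => //= k ->.
    rewrite fix_al in Ei; have -> : w = c by exact: (congr1 (@tip _) Ei).
    by rewrite adj_irr.
  apply: (ore_good_drawing xy A0 Az cd1 cd2 g1 g2 xyab (alpha := al) (beta := be)) => //.
  - by rewrite wA.
  - rewrite wA; apply: contra bal => /eqP E; apply/eqP.
    exact: (dart_inj (tbe : tail be = tail al) E).
  - move=> e ez; rewrite !wA !inE.
    have tE f : tail f = z -> (tip f == w) = (f == al).
      by move=> fz; apply/eqP/eqP => [E|-> //]; apply: dart_inj.
    rewrite !tE ?rotation_tail // -(inj_eq (@perm_inj _ r2) e al) -/be.
    have [->|_] := eqVneq (r2 e) al; first by rewrite eq_sym (negPf bal).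
    by case: (r2 e == be).
  - exact: (f2 al c d zwcd).
  (* The successor of zw around z lies on the face of wz, the second triangular face at this middle
     edge. *)
  have -> : be = face_step r2 (dart_rev al) by rewrite /face_step dart_revK.
  rewrite /face_length order_step; last exact: face_step_inj.
  exact: (f2 (dart_rev al) c d (cn2C zwcd)).
have [zp zq' mo] : [/\ adj z p, adj z q' & moser_at z p q p' q'].
  by split; [case/and3P: t|case/and3P: t'|exact: bt2].
have [r2 [g2 la lb rE]] := moser_rotation zp zq' mo; have [[rs2 _] _ _] := g2.
move: (U); rewrite /= !inE !negb_or => /and4P[/and3P[pq pp' pq'] /andP[qp' qq'] p'q' _].
apply: (ore_good_drawing xy A0 Az cd1 cd2 g1 g2 xyab
  (alpha := mk_dart zp) (beta := mk_dart zq')) => //.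
- by rewrite AE !inE eqxx.
- by rewrite AE !inE negb_or /tip /= ![q' == _]eq_sym pq' p'q'.
move=> e ez; have tE f v (zv : adj z v) : tail f = z -> (f == mk_dart zv) = (tip f == v).
  by move=> fz; apply/eqP/eqP => [-> //|E]; apply: dart_inj.
rewrite AE !inE !tE ?rotation_tail // !rE //.
have sy (s t0 : G2) : s != t0 -> (t0 == s) = false by rewrite eq_sym => /negPf.
have N := (negPf pq, negPf pp', negPf pq', negPf qp', negPf qq', negPf p'q').
have N' := (sy _ _ pq, sy _ _ pp', sy _ _ pq', sy _ _ qp', sy _ _ qq', sy _ _ p'q').
have := dart_adj e; rewrite ez (moser_at_nbr _ mo) !inE => /or4P[] /eqP ->;
  by rewrite /= !(eqxx, N, N').
Qed.

Lemma ore_triangle_left u s t : triangle_at (lft u) (lft s) (lft t) -> triangle_at u s t.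
Proof. by rewrite /triangle_at !ore_adj_ll => /and3P[/and3P[-> _ _] /and3P[-> _ _] /and3P[-> _ _]]. Qed.

Lemma ore_triangle_right w (s t : O) :
  triangle_at (rgt w) s t -> triangle_at (val w) (ore_proj s) (ore_proj t).
Proof.
case/and3P=> ws wt st; rewrite /triangle_at (inr_adj_proj ws) (inr_adj_proj wt) /=.
case: t wt st => [t|t] wt st; last first.
  by rewrite adj_sym; apply: inr_adj_proj; rewrite adj_sym.
case: s ws st => [s|s] ws st; last exact: inr_adj_proj st.
by case: (@no_mixed _ _ x y z A s t w); rewrite // adj_sym.
Qed.

(** G1 would be a Moser spindle with centre u, whose diamonds have the outer edges of the bow tie as
    middle edges. So xy would be one of these edges, but it has been deleted. *)
Lemma no_bowtie_left u p q p' q' : u != x -> u != y ->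
  triangle_at (lft u) p q -> triangle_at (lft u) p' q' -> uniq [:: p; q; p'; q'] -> False.
Proof.
move=> ux uy.
have nb s : adj (lft u) s -> exists s', s = lft s'.
  case: s => [s|s]; first by exists s.
  by rewrite ore_adj_lr /attach => /andP[_]; case: ifP; rewrite (negPf ux, negPf uy).
move=> t t' U; have [[s pE] [s0 qE]] : (exists s, p = lft s) /\ exists s, q = lft s.
  by case/and3P: t => /nb ? /nb ?.
have [[s' pE'] [s0' qE']] : (exists s, p' = lft s) /\ exists s, q' = lft s.
  by case/and3P: t' => /nb ? /nb ?.
move: t t' U; rewrite pE qE pE' qE' => t t' U.
have inlI : injective (inl : G1 -> O) by exact: inl_inj.
have U1 : uniq [:: s; s0; s'; s0'] by rewrite -(map_inj_uniq inlI).
have mo := st_bowties s1 (ore_triangle_left t) (ore_triangle_left t') U1.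
have /and3P[_ _ st] := t; have /and3P[_ _ st'] := t'.
have := moser_at_mid mo xyab; rewrite !inE => /or4P[] /eqP[Ex Ey].
- by move: st; rewrite -Ex -Ey ore_adj_xy.
- by move: st; rewrite -Ex -Ey ore_adj_yx.
- by move: st'; rewrite -Ex -Ey ore_adj_xy.
- by move: st'; rewrite -Ex -Ey ore_adj_yx.
Qed.

Lemma att_in s t : (att s == att t) = ((s \in A) == (t \in A)).
Proof.
rewrite /attach; case: (s \in A); case: (t \in A); rewrite ?eqxx //.
  exact/negbTE/adj_neq.
by rewrite eq_sym; exact/negbTE/adj_neq.
Qed.

(** If z is split along a bow tie, it has four neighbours and would be the centre of the spindle,
    which is w. If it is split along a diamond, the edge from z to [w0] is a middle edge and hence
    an edge of a triangle at w; that triangle is destroyed because only [w0] is in A. *)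
Lemma no_bowtie_right w p q p' q' :
  triangle_at (rgt w) p q -> triangle_at (rgt w) p' q' -> uniq [:: p; q; p'; q'] ->
  moser_at (val w) (ore_proj p) (ore_proj q) (ore_proj p') (ore_proj q') -> False.
Proof.
move=> t t' U mo.
case: split => [[w0 [c [d [zw AE]]]]|[p0 [q0 [p0' [q0' [t0 t0' U0 _]]]]]]; last first.
  have := valP w; rewrite /= -(moser_at_center (u := z) (s := [:: p0; q0; p0'; q0']) mo) ?eqxx //.
  move: t0 t0' => /and3P[z1 z2 _] /and3P[z3 z4 _] v.
  by rewrite !inE => /or4P[] /eqP ->.
have zw0 : adj z w0 by case/and5P: zw.
have key (s r : O) : triangle_at (rgt w) s r -> ore_proj s = z -> ore_proj r = w0 -> False.
  case: s => [s|s]; last by move=> _ E; case/eqP: (valP s).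
  case: r => [r|r]; first by move=> _ _ E; have := adj_neq zw0; move/eqP; case.
  move=> /and3P[+ wr +] _ E; rewrite ore_adj_rl ore_adj_lr => /andP[_ /eqP ->] /andP[_].
  have {}wr : adj (val w) (val r) by exact: wr.
  rewrite att_in AE !inE [X in _ == X](_ : _ = true); last by apply/eqP; exact: E.
  by rewrite eqb_id -E => /eqP wE; move: wr; rewrite wE adj_irr.
have := moser_at_mid mo zw; rewrite !inE => /or4P[] /eqP[Ez Ew].
- exact: key t (esym Ez) (esym Ew).
- apply: (key q p) (esym Ez) (esym Ew).
  by case/and3P: t => h1 h2 h3; rewrite /triangle_at h2 h1 adj_sym.
- exact: key t' (esym Ez) (esym Ew).
- apply: (key q' p') (esym Ez) (esym Ew).
  by case/and3P: t' => h1 h2 h3; rewrite /triangle_at h2 h1 adj_sym.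
Qed.

(** In the diamond case s and t are its ends c and d, and the split-off vertex is the fourth one. In
    the bow tie case there is no such edge, as two neighbours of the centre on the same side belong
    to different diamonds and are not adjacent. *)
Lemma right_fourth s t : adj z s -> adj z t -> adj s t -> att s = att t ->
  exists w, [/\ cn2 s t z w, adj z w & att w != att s].
Proof.
move=> zs zt st /eqP; rewrite att_in => /eqP E.
case: split => [[w [c [d [zw AE]]]]|[p [q [p' [q' [t1 t1' U AE]]]]]].
  rewrite AE !inE in E; have := cd2 zw zs; have := cd2 zw zt; rewrite !inE.
  case/and5P: (zw) => zw' cd zc wc /andP[zd wd].
  have [tw|tw] := eqVneq t w.
    by move: E; rewrite tw eqxx => /eqP sw; move: st; rewrite sw tw adj_irr.
  have sw : s != w by rewrite E (negPf tw).
  rewrite (negPf sw) /= => tcd scd.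
  exists w; split=> //; last by rewrite att_in AE !inE eqxx (negPf sw).
  have zw2 : z != w by exact: adj_neq.
  have aw v : (v == c) || (v == d) -> adj v w by case/orP => /eqP ->; rewrite adj_sym.
  by rewrite /cn2 st zw2 (aw s scd) (aw t tcd) adj_sym zs adj_sym zt.
have mo := bt2 t1 t1' U.
have flip r r' : triangle_at z r r' -> triangle_at z r' r.
  by case/and3P=> h1 h2 h3; rewrite /triangle_at h2 h1 adj_sym.
move: U; rewrite /= !inE !negb_or => /and4P[/and3P[pq pp' pq'] /andP[qp' qq'] p'q' _].
have sy (r t0 : G2) : r != t0 -> (t0 == r) = false by rewrite eq_sym => /negPf.
have N := (negPf pq, negPf pp', negPf pq', negPf qp', negPf qq', negPf p'q').
have N' := (sy _ _ pq, sy _ _ pp', sy _ _ pq', sy _ _ qp', sy _ _ qq', sy _ _ p'q').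
have U' : uniq [:: q; p; q'; p'] by rewrite /= !inE !(N, N').
have mo' := bt2 (flip _ _ t1) (flip _ _ t1') U'.
have n1 := moser_at_nonadj mo; have n2 := moser_at_nonadj mo'.
have n1' : adj p' p = false by rewrite adj_sym.
have n2' : adj q' q = false by rewrite adj_sym.
move: E; rewrite AE !inE.
have := zs; have := zt; rewrite !(moser_at_nbr _ mo) !inE.
by move=> /or4P[] /eqP tE /or4P[] /eqP sE; subst s t;
  rewrite !(eqxx, N, N') //= => _; move: st; rewrite ?(adj_irr, n1, n2, n1', n2').
Qed.


Lemma end_left_nbr u u' r : (u = x /\ u' = y) \/ (u = y /\ u' = x) ->
  adj (lft u) (lft r) -> r \in [:: a; b].
Proof.
move=> ends ur.
have c1 : cn2 u u' a b by case: ends => -[-> ->]; rewrite ?xyab // cn2C.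
have ur1 : adj u r by move: ur; rewrite ore_adj_ll => /andP[].
have := cd1 c1 ur1; rewrite !inE => /or3P[/eqP rE| -> | ->]; rewrite ?orbT //.
by move: ur; rewrite rE; case: ends => -[-> ->]; rewrite ?ore_adj_xy ?ore_adj_yx.
Qed.

(** The left triangle makes a and b adjacent, so G1 is K4; the right one forces G2 to be K4 by
    [right_fourth]. The composition of two copies of K4 is then the spindle, with [u'] and w as its
    two remaining vertices. *)
Lemma bowtie_end u u' s t s' t' : (u = x /\ u' = y) \/ (u = y /\ u' = x) ->
  triangle_at (lft u) (lft s) (lft t) -> triangle_at (lft u) (rgt s') (rgt t') ->
  moser_at (lft u) (lft s) (lft t) (rgt s') (rgt t').
Proof.
move=> ends tl tr.
have c1 : cn2 u u' a b by case: ends => -[-> ->]; rewrite ?xyab // cn2C.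
have uu' : adj (lft u) (lft u') = false.
  by case: ends => -[-> ->]; rewrite ?ore_adj_xy ?ore_adj_yx.
have attE w : (att w == u) = (att w != u').
  have xyn := negPf (adj_neq xy); have yxn : (y == x) = false by rewrite eq_sym xyn.
  by case: ends => -[-> ->]; rewrite /attach; case: ifP; rewrite ?eqxx ?xyn ?yxn.
have /and3P[us ut st] := ore_triangle_left tl.
have nsu' r : adj (lft u) (lft r) -> (r == a) || (r == b).
  by move/(end_left_nbr ends); rewrite !inE.
have sab := nsu' s (proj1 (andP tl)).
have tab : (t == a) || (t == b) by case/and3P: tl => _ /nsu'.
have u'adj r : (r == a) || (r == b) -> adj u' r.
  by case/and5P: c1 => _ _ _ ? /andP[_ ?] /orP[] /eqP ->.
have cst : cn2 u u' s t.
  have uu1 : adj u u' by case/and5P: c1.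
  by rewrite /cn2 uu1 (adj_neq st) us ut (u'adj s sab) (u'adj t tab).
have [card1 _] := K4_component (st_conn s1) cd1 cst st.
have [zs' us'] : adj z (val s') /\ u = att (val s').
  by case/and3P: tr; rewrite ore_adj_lr => /andP[? /eqP].
have [zt' ut'] : adj z (val t') /\ u = att (val t').
  by case/and3P: tr => _; rewrite ore_adj_lr => /andP[? /eqP].
have st' : adj (val s') (val t') by case/and3P: tr.
have [w [cw zw aw]] := right_fourth zs' zt' st' (etrans (esym us') ut').
have [card2 _] := K4_component (st_conn s2) cd2 cw zw.
have wz : w != z by rewrite eq_sym adj_neq.
have aw' : u' = att w by apply/eqP; rewrite eq_sym; apply/negbNE; rewrite -attE us'.
pose w' : {w : G2 | w != z} := exist _ w wz.
have /and5P[_ _ _ _ /andP[sw tw]] := cw.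
have inlE r r' : (lft r == lft r') = (r == r') by rewrite (inj_eq inl_inj).
have inrE r r' : (rgt r == rgt r') = (r == r') by rewrite (inj_eq inr_inj).
have u's : adj u' s by exact: u'adj.
have u't : adj u' t by exact: u'adj.
have inner r : adj u r -> adj u' r -> (r == x) = false /\ (r == y) = false.
  move=> /adj_neq ur /adj_neq u'r.
  by split; apply/negbTE; case: ends => -[Eu Eu']; rewrite eq_sym -?Eu -?Eu'.
have [sx sy] := inner s us u's; have [tx ty] := inner t ut u't.
apply: (@moser_atI O _ _ _ _ _ (lft u') (rgt w')).
- rewrite /= !inE !inlE !inrE /= !orbF.
  rewrite (negPf (adj_neq us)) (negPf (adj_neq ut)) (negPf (adj_neq st)) (eq_sym s u') (eq_sym t u').
  rewrite (negPf (adj_neq u's)) (negPf (adj_neq u't)) -!(inj_eq val_inj) /=.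
  rewrite (negPf (adj_neq st')) (negPf (adj_neq sw)) (negPf (adj_neq tw)) /= !andbT.
  by apply: adj_neq; case/and5P: c1.
- by have := card_ore x y z A; rewrite card1 card2 => /eqP; rewrite -[4 + 4]/(7 + 1) eqn_add2r => /eqP.
have linkE r v : ore_link x y z A r v = adj z v && (r == att v).
  by rewrite /ore_link /attach; case: (v \in A); rewrite ?andbT ?andbF ?orbF.
have nlink r v : (r == x) = false -> (r == y) = false -> ore_link x y z A r v = false.
  by move=> rx ry; rewrite linkE /attach; case: ifP; rewrite ?rx ?ry andbF.
have nuu : (u == u') = false by apply/negbTE/adj_neq; case/and5P: c1.
have ll r r' : adj r r' -> (r == x) = false -> (r == y) = false -> adj (lft r) (lft r').
  by move=> rr rx ry; rewrite ore_adj_ll rr !xpair_eqE rx ry.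
have ls : adj (lft s) (lft u') by apply: ll; rewrite // adj_sym.
have lt_ : adj (lft t) (lft u') by apply: ll; rewrite // adj_sym.
have /and3P[tl1 tl2 tl3] := tl; have /and3P[tr1 tr2 tr3] := tr.
have sw' : adj (rgt s') (rgt w') by [].
have tw' : adj (rgt t') (rgt w') by [].
have u'u : (u' == u) = false by rewrite eq_sym.
case=> [|[|[|[|[|[|[|i]]]]]]] [|[|[|[|[|[|[|j]]]]]]] //= ij;
  rewrite ?(tl1, tl2, tl3, tr1, tr2, tr3, ls, lt_, sw', tw', uu') // ?(nlink _ _ sx sy) ?(nlink _ _ tx ty) //.
- by rewrite linkE -aw' nuu andbF.
- by rewrite linkE -us' u'u andbF.
- by rewrite linkE -ut' u'u andbF.
- by rewrite linkE -aw' eqxx andbT zw.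
- by case/andP: ij.
Qed.

(** Only a bow tie at x or y with one triangle in each factor survives. Two left triangles there
    would need four left neighbours, while only a and b remain; with two right ones z would be the
    centre of a spindle with all its neighbours on one side. *)
Lemma ore_bowties : moser_bowties O.
Proof.
move=> [u|w] p q p' q' t t' U; last first.
  have wp : adj (rgt w) p by case/and3P: t.
  have wq : adj (rgt w) q by case/and3P: t.
  have wp' : adj (rgt w) p' by case/and3P: t'.
  have wq' : adj (rgt w) q' by case/and3P: t'.
  have pinj : {in [:: p; q; p'; q'] &, injective (@ore_proj _ _ x y z A)}.
    have nb r : r \in [:: p; q; p'; q'] -> adj (rgt w) r.
      by rewrite !inE => /or4P[] /eqP ->.
    by move=> r r' /nb wr /nb wr'; exact: ore_proj_inj wr wr'.
  have U2 : uniq [:: ore_proj p; ore_proj q; ore_proj p'; ore_proj q'].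
    by rewrite -(map_inj_in_uniq pinj) in U.
  case: (no_bowtie_right t t' U).
  exact: bt2 (ore_triangle_right t) (ore_triangle_right t') U2.
have [uxy|] := boolP ((u == x) || (u == y)); last first.
  by rewrite negb_or => /andP[ux uy]; case: (no_bowtie_left ux uy t t' U).
have [u' ends] : exists u', (u = x /\ u' = y) \/ (u = y /\ u' = x).
  by case/orP: uxy => /eqP ->; [exists y; left|exists x; right].
have mixed r r' : adj (lft u) (lft r) -> adj (lft u) (rgt r') -> adj (lft r) (rgt r') -> False.
  exact: no_mixed.
case: p q t U => [p|p] [q|q] t U; try by case/and3P: t => h1 h2 h3;
  first [case: (mixed _ _ h1 h2 h3) | rewrite adj_sym in h3; case: (mixed _ _ h2 h1 h3)].
- case: p' q' t' U => [p'|p'] [q'|q'] t' U; try by case/and3P: t' => h1 h2 h3;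
    first [case: (mixed _ _ h1 h2 h3) | rewrite adj_sym in h3; case: (mixed _ _ h2 h1 h3)].
    have inlI : injective (inl : G1 -> O) by exact: inl_inj.
    have U1 : uniq [:: p; q; p'; q'] by rewrite -(map_inj_uniq inlI).
    have /and3P[h1 h2 _] := t; have /and3P[h3 h4 _] := t'.
    suff /(uniq_leq_size U1) : {subset [:: p; q; p'; q'] <= [:: a; b]} by [].
    by move=> r; rewrite !in_cons in_nil orbF => /or4P[] /eqP ->; apply: (end_left_nbr ends).
  exact: bowtie_end ends t t'.
- case: p' q' t' U => [p'|p'] [q'|q'] t' U; try by case/and3P: t' => h1 h2 h3;
    first [case: (mixed _ _ h1 h2 h3) | rewrite adj_sym in h3; case: (mixed _ _ h2 h1 h3)].
    exact/moser_at_swap/(bowtie_end ends t' t).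
  have [h1 h2 h3] := and3P t; have [h1' h2' h3'] := and3P t'.
  move: h1 h2 h1' h2'; rewrite !ore_adj_lr => /andP[zp /eqP up] /andP[zq /eqP uq].
  move=> /andP[zp' /eqP up'] /andP[zq' /eqP uq'].
  have inrI : injective (fun v : {v | v != z} => rgt v) by exact: inr_inj.
  have U2 : uniq [:: val p; val q; val p'; val q'].
    rewrite -[X in uniq X]/(map val [:: p; q; p'; q']) (map_inj_uniq val_inj).
    by rewrite -(map_inj_uniq inrI).
  have mo : moser_at z (val p) (val q) (val p') (val q').
    by apply: bt2 U2; apply/and3P; split.
  have attu v : adj z v -> att v = u.
    by rewrite (moser_at_nbr _ mo) !inE => /or4P[] /eqP ->.
  have [AN [e eN eA]] := properP Az; have [f fA] := set0Pn _ A0.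
  have ex : u = x by rewrite -(attu f) /attach ?fA //; have := subsetP AN f fA; rewrite inE.
  have ey : u = y by rewrite -(attu e) /attach ?(negPf eA) //; move: eN; rewrite inE.
  by case/eqP: (adj_neq xy); rewrite -ex -ey.
Qed.

Lemma ore_structured : structured O.
Proof.
split.
- exact: ore_connected.
- exact: ore_closed_diamonds.
- exact: ore_bowties.
- exact: ore_critical.
- exact: ore_drawing.
Qed.

End Step.

(** The two destroyed triangles share a second vertex in A, share one outside A, or share only z.
    The second case becomes the first by exchanging x and y. In each case the known neighbourhood of
    z, from the diamond or from the spindle, determines A. *)
Lemma four_triangles_structured G : four_Ore G -> #|triangles G| = 4 -> structured G.
Proof.
elim=> {G} [G /isK4_iso/(_ isK4_K4) K _|G1 G2 G x y z A o1 IH1 o2 IH2 xy A0 Az GO].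
  exact: structured_K4.
have [h bh hadj] := GO; rewrite -(card_triangles_isoT bh hadj) => T4.
apply: structured_iso GO _.
have [T1 [a [b c]]] := left_triangles4 xy A0 Az o1 o2 T4.
have [T2 [p [q [p' [q' [/andP[pA qA] /andP[pA' qA'] ne t t']]]]]] := right_triangles4 xy A0 Az o1 o2 T4.
have s1 := IH1 T1; have s2 := IH2 T2; have cd2 := st_diamonds s2.
have AN w : w \in A -> adj z w by move/(subsetP (proper_sub Az)); rewrite inE.
have /and3P[zp zq pq] := t; have /and3P[zp' zq' pq'] := t'.
have [pE|pp'] := eqVneq p p'.
  have zc : cn2 z p q q'.
    have qq' : q != q' by apply: contra ne => /eqP qE; rewrite pE qE.
    by rewrite /cn2 zp qq' zq pq zq' pE pq'.
  apply: (ore_structured xy A0 Az s1 s2 c); left; exists p, q, q'; split=> //.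
  apply/setP => w; rewrite inE; apply/idP/eqP => [wA|-> //].
  have := cd2 _ _ _ _ _ zc (AN w wA); rewrite !inE => /or3P[] /eqP E //.
    by rewrite E (negPf qA) in wA.
  by rewrite E (negPf qA') in wA.
have [qE|qq'] := eqVneq q q'.
  have zc : cn2 z q p p'.
    by rewrite /cn2 zq pp' zp zp' adj_sym pq qE adj_sym pq'.
  apply: structured_iso (ore_swap x y z A) _.
  have yx : adj y x by rewrite adj_sym.
  have E : neighbours z :\: A = [set q].
    apply/setP => w; rewrite !inE; apply/andP/eqP => [[wA zw]|->]; last by rewrite qA zq.
    have := cd2 _ _ _ _ _ zc zw; rewrite !inE => /or3P[] /eqP E //.
      by rewrite E pA in wA.
    by rewrite E pA' in wA.
  apply: (ore_structured yx _ _ s1 s2 (cn2C c)).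
  - by rewrite E; apply/set0Pn; exists q; rewrite inE.
  - apply/properP; split; first exact: subsetDl.
    by exists p; rewrite !inE ?zp ?pA.
  - by left; exists q, p, p'.
have U : uniq [:: p; q; p'; q'].
  have pq0 : p != q by exact: adj_neq.
  have pq1 : p' != q' by exact: adj_neq.
  have pq2 : p != q' by apply: contraNneq qA' => <-.
  have pq3 : q != p' by apply: contraNneq qA => ->.
  by rewrite /= !inE !negb_or pq0 pp' pq2 pq3 qq' pq1.
have mo := st_bowties s2 t t' U.
apply: (ore_structured xy A0 Az s1 s2 c); right; exists p, q, p', q'; split=> //.
apply/setP => w; rewrite !inE; apply/idP/orP => [wA|[] /eqP -> //].
have := AN w wA; rewrite (moser_at_nbr _ mo) !inE => /or4P[] /eqP E; rewrite E ?eqxx //.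
- by left.
- by rewrite E (negPf qA) in wA.
- by right.
- by rewrite E (negPf qA') in wA.
Qed.

Lemma structured_Pl44f G : four_Ore G -> structured G -> #|triangles G| = 4 -> Pl44f G.
Proof.
move=> oG [con _ _ ec [r [sp n4 _]]] T4.
have G2 : 1 < #|G|.
  have /card_gt0P[t tG] : 0 < #|triangles G| by rewrite T4.
  by apply: leq_trans (max_card t); rewrite (card_triangle tG).
have pl := spherical_plane con G2 sp.
split; last by exists r.
by split=> //; [exists r|exact: edge_critical_four_critical].
Qed.

Theorem theorem3 (G : sgraph) (hG : four_Ore G) :
  4 <= #|triangles G| /\ (#|triangles G| = 4 <-> Pl44f G).
Proof.
split; first exact: four_Ore_ge4.
(* The converse holds because having four triangles is part of [Pl4]. *)
split=> [T4|[[_ _ //]]].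
exact: structured_Pl44f (four_triangles_structured hG T4) T4.
Qed.
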